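(* Let $n\ge3$, let $\Omega\subset\mathbb{R}^n$ be a bounded domain with smooth boundary, let $u$ solve $\Delta u=-n$ in $\Omega$, $u=0$ on $\partial\Omega$, and let $N$ be a connected component of $\Omega\setminus\mathrm{MAX}(u)$. Then $\tau(u,N)\ge1$, and equality holds if and only if $(\Omega,u)$ is equivalent to the Serrin solution $\Omega_0=B_1(0)$, $u_0(x)=\frac{1-|x|^2}{2}$.
   Context: $u_{\max}=\max_\Omega u$, $\mathrm{MAX}(u)=\{x\in\Omega:u(x)=u_{\max}\}$. NWSS: for a connected component $S$ of $\partial\Omega$, $\tau(u,S)=\max_S|\nabla u|/\sqrt{2u_{\max}}$; $\tau(u,N)$ is the maximum of $\tau(u,S)$ over the connected components $S$ of $\partial\Omega\cap\overline N$ (a nonempty set). Equivalence: $\bar\Omega=\{\lambda x+c:x\in\Omega\}$, $\bar u(y)=\lambda^2u((y-c)/\lambda)$ for some $\lambda>0$, $c\in\mathbb{R}^n$. *)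

(* Defs.v *)
From HB Require Import structures.
From mathcomp Require Import all_boot all_order all_algebra.
From mathcomp Require Import all_classical all_reals all_analysis.
Set Implicit Arguments. Unset Strict Implicit. Unset Printing Implicit Defensive.
Import Order.TTheory GRing.Theory Num.Theory.
Import numFieldNormedType.Exports.
Local Open Scope classical_set_scope.
Local Open Scope ring_scope.

Section Defs.
Variables (R : realType) (n : nat).
Notation V := 'rV[R]_n.

Definition evec (i : 'I_n) : V := delta_mx 0 i.

(* Euclidean norm (the library norm on 'rV is the max norm) *)
Definition enorm (x : V) : R := Num.sqrt (\sum_(i < n) x 0 i ^+ 2).

Definition partial (i : 'I_n) (f : V -> R) : V -> R := fun x => 'D_(evec i) f x.

Fixpoint iter_partial (s : seq 'I_n) (f : V -> R) : V -> R :=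
  match s with [::] => f | i :: s' => partial i (iter_partial s' f) end.

Definition smooth (f : V -> R) : Prop :=
  forall s : seq 'I_n, continuous (iter_partial s f) /\
    forall (i : 'I_n) (x : V), derivable (iter_partial s f) x (evec i).

Definition bdry (A : set V) : set V := closure A `\` A.

Definition bounded_domain (Om : set V) : Prop :=
  Om !=set0 /\ open Om /\ connected Om /\ exists M : R, forall x, Om x -> enorm x <= M.

Definition smooth_boundary (Om : set V) : Prop :=
  exists rho : V -> R, smooth rho /\ Om = [set x | rho x < 0] /\
    forall x, bdry Om x -> exists i : 'I_n, partial i rho x != 0.

(* u is a classical solution of  Delta u = -n in Om, u = 0 on bdry Om,
   u in C^2(Om) cap C^1(closure Om); G is the (continuous extension to
   closure Om of the) gradient of u. *)
Definition serrin_solution (Om : set V) (u : V -> R) (G : V -> V) : Prop :=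
  {within closure Om, continuous u} /\
  {within closure Om, continuous G} /\
  (forall x, bdry Om x -> u x = 0) /\
  (forall x, Om x -> forall i : 'I_n,
      derivable u x (evec i) /\ G x 0 i = partial i u x) /\
  (forall i j : 'I_n, forall x, Om x -> derivable (partial i u) x (evec j)) /\
  (forall i j : 'I_n, {within Om, continuous (partial j (partial i u))}) /\
  (forall x, Om x -> \sum_(i < n) partial i (partial i u) x = - n%:R).

Definition umax (Om : set V) (u : V -> R) : R := sup (u @` Om).

Definition MAXset (Om : set V) (u : V -> R) : set V :=
  [set x | Om x /\ u x = umax Om u].

Definition components (A : set V) : set (set V) :=
  [set connected_component A x | x in A].

Definition tauS (Om : set V) (u : V -> R) (G : V -> V) (S : set V) : R :=
  sup ((fun x => enorm (G x)) @` S) / Num.sqrt (2 * umax Om u).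

Definition tauN (Om : set V) (u : V -> R) (G : V -> V) (N : set V) : R :=
  sup [set tauS Om u G S | S in components (bdry Om `&` closure N)].

Definition unit_ball : set V := [set x | enorm x < 1].
Definition u0 (x : V) : R := (1 - enorm x ^+ 2) / 2.

Definition equiv_serrin (Om : set V) (u : V -> R) : Prop :=
  exists (lam : R) (c : V), 0 < lam /\
    Om = [set lam *: x + c | x in unit_ball] /\
    forall y, Om y -> u y = lam ^+ 2 * u0 (lam^-1 *: (y - c)).

End Defs.

(* Main.v *)
(** Payne's P-function [P = |grad u|^2 + 2 u] satisfies
    [Lap P = 2 (|D^2 u|^2 - n) >= 0] because [Lap u = -n], with equality only
    where [D^2 u = -I].  On [MAX(u)] one has [P = 2 umax], and [tau(u,N) <= 1]
    says that [P <= 2 umax] on the rest of the boundary of [N]; hence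
    [P <= 2 umax] in [N].  The gradient of [P] vanishes wherever [P] reaches
    [2 umax] in the closure of [N] inside [Omega], so Hopf's lemma on a ball
    touching [{P < 2 umax}] from inside forces [P = 2 umax] on [N].  Then
    [D^2 u = -I] on [N], [u] is a concave paraboloid there, and connectedness
    identifies [Omega] with a ball.  For the Serrin solution itself [tau = 1],
    so [tau < 1] is impossible. *)
Require Import Defs.
From HB Require Import structures.
From mathcomp Require Import all_boot all_order all_algebra.
From mathcomp Require Import all_classical all_reals all_analysis.
From mathcomp Require Import ring lra.
Set Implicit Arguments. Unset Strict Implicit. Unset Printing Implicit Defensive.
Import Order.TTheory GRing.Theory Num.Theory.
Import numFieldNormedType.Exports.
Local Open Scope classical_set_scope.
Local Open Scope ring_scope.

(** The obstacle is regularity: [u] is only C^2 inside [Om], so [Pfunc] is only C^1, and computing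
    its Laplacian would take third derivatives of [u]. The differential inequality is therefore put
    in viscosity form: if [Pfunc + phi] has a local maximum at [z] for a smooth [phi], then
    [hess_defect z + Lap phi z <= 0]. It is proved by replacing the gradient inside [Pfunc] by
    forward difference quotients of step [t]. The result is C^2, and the terms that would tend to
    third derivatives add up to a difference quotient of the constant [Lap u], so they vanish for
    each fixed [t]. The maximum principle, Hopf's lemma and the equality case all follow by choosing
    a test function: a small multiple of [sqdist 0], a barrier, and zero. The passage from
    paraboloid to ball rests on the fact that a point does not separate a ball in dimension at least
    two: the paraboloid has its maximum only at its centre [c], so [N] fills the whole punctured
    ball of squared radius [2 * umax], and [u] reaches zero on the sphere, which [Om] cannot
    cross. *)

Section Calculus.
Variables (R : realType) (n : nat).
Notation V := 'rV[R]_n.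
Implicit Types (x y z v : V) (f : V -> R).

(** * Calculus along lines: mean values, derivative tests at a maximum, Lipschitz bounds *)

Lemma coord_le_norm x i : `|x 0 i| <= `|x|.
Proof.
rewrite /Num.norm/= mx_normrE.
exact: (le_bigmax_cond _ (fun ij : 'I_1 * 'I_n => `|x ij.1 ij.2|) (j := (0, i))).
Qed.

Lemma norm_le_coord x r : 0 <= r -> (forall i, `|x 0 i| <= r) -> `|x| <= r.
Proof.
move=> r0 h; rewrite /Num.norm/= mx_normrE.
by apply: bigmax_le => // -[i j] _ /=; rewrite ord1.
Qed.

Lemma evecE (i j : 'I_n) : evec R i 0 j = (j == i)%:R.
Proof. by rewrite /evec mxE eqxx. Qed.

Lemma norm_scale_evec (t : R) (i : 'I_n) : `|t *: evec R i| <= `|t|.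
Proof.
apply: norm_le_coord => // j; rewrite mxE evecE normrM.
by case: eqP => _; rewrite ?normr1 ?normr0 ?mulr1 ?mulr0.
Qed.

Lemma is_derive_line f x v (t l : R) :
  is_derive (x + t *: v) v f l -> is_derive t 1 (fun s : R => f (x + s *: v)) l.
Proof.
have E : (fun h : R => h^-1 *: ((f \o shift (x + t *: v)) (h *: v) - f (x + t *: v)))
  = (fun h : R => h^-1 *: (((fun s : R => f (x + s *: v)) \o shift t) (h *: 1)
      - (fun s : R => f (x + s *: v)) t)).
  apply/funext => h /=; congr (_ *: (f _ - _)).
  by rewrite [h *: 1]mulr1 scalerDl addrCA.
by case=> d1 d2; split; [move: d1; rewrite /derivable E|rewrite /derive -E].
Qed.

(** Both signs of [t] are allowed because [Pfun_diff_approx] applies the mean value theorem a second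
    time, at an intermediate point known only through its absolute value. *)
Lemma MVT_line f (df : V -> R) x v (t : R) :
  (forall s, `|s| <= `|t| -> is_derive (x + s *: v) v f (df (x + s *: v))) ->
  exists2 s, `|s| <= `|t| & f (x + t *: v) - f x = t * df (x + s *: v).
Proof.
move=> h.
have dl (s : R) : `|s| <= `|t| ->
    is_derive s (1 : R) (fun s : R => f (x + s *: v)) (df (x + s *: v)).
  by move=> st; apply: is_derive_line; exact: h.
have [t0|t0] := leP 0 t.
  have st (s : R) : s \in `[0, t] -> `|s| <= `|t|.
    by rewrite in_itv/= => /andP[a b]; rewrite !ger0_norm.
  have [s sI E] := @MVT_segment R (fun s : R => f (x + s *: v))
    (fun s => df (x + s *: v)) 0 t t0
    (fun s sI => dl s (st s (subset_itv_oo_cc sI)))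
    (derivable_within_continuous (fun s sI => @ex_derive _ _ _ _ _ _ _ (dl s (st s sI)))).
  by exists s; [exact: st|move: E; rewrite scale0r addr0 subr0 mulrC].
have st (s : R) : s \in `[t, 0] -> `|s| <= `|t|.
  by rewrite in_itv/= => /andP[a b]; rewrite (ltr0_norm t0) ler0_norm// lerN2.
have [s sI E] := @MVT_segment R (fun s : R => f (x + s *: v))
  (fun s => df (x + s *: v)) t 0 (ltW t0)
  (fun s sI => dl s (st s (subset_itv_oo_cc sI)))
  (derivable_within_continuous (fun s sI => @ex_derive _ _ _ _ _ _ _ (dl s (st s sI)))).
exists s; first exact: st.
move: E; rewrite scale0r addr0 sub0r => E.
by rewrite -opprB E mulrN opprK mulrC.
Qed.

Lemma derive_local_max f (df : V -> R) z v r : 0 < r ->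
  (forall s, `|s| < r -> is_derive (z + s *: v) v f (df (z + s *: v))) ->
  (forall s, `|s| < r -> f (z + s *: v) <= f z) -> df z = 0.
Proof.
move=> r0 h hm.
have I0 : (0 : R) \in `](- r), r[ by rewrite in_itv/=; lra.
have dl (s : R) : s \in `](- r), r[ ->
    is_derive s (1 : R) (fun s : R => f (z + s *: v)) (df (z + s *: v)).
  move=> sI; apply: is_derive_line; apply: h.
  by move: sI; rewrite in_itv/= ltr_norml.
have d0 := dl 0 I0.
have [_ e0] := @derive1_at_max R (fun s : R => f (z + s *: v)) (- r) r 0
  (ltac:(lra)) (fun s sI => @ex_derive _ _ _ _ _ _ _ (dl s sI)) I0
  (fun s sI => ltac:(move: sI; rewrite in_itv/= -ltr_norml scale0r addr0; exact: hm)).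
by move: e0; rewrite (@derive_val _ _ _ _ _ _ _ d0) scale0r addr0.
Qed.

(** No Taylor expansion is needed, only the derivative of [df] at [z] itself: since [df z = 0], a
    positive [l] makes [df] positive just after [z], and the mean value theorem then makes [f]
    exceed [f z]. *)
Lemma derive2_local_max f (df : V -> R) z v r l : 0 < r ->
  (forall s, `|s| < r -> is_derive (z + s *: v) v f (df (z + s *: v))) ->
  is_derive z v df l ->
  (forall s, `|s| < r -> f (z + s *: v) <= f z) -> l <= 0.
Proof.
move=> r0 h dl hm.
have df0 := derive_local_max r0 h hm.
rewrite leNgt; apply/negP => l0.
have c : (fun h : R => h^-1 *: ((df \o shift z) (h *: v) - df z)) @ 0^' --> l.
  by case: dl => d1 <-.
have /nbhs_ballP[e /= e0 he] : nbhs 0^' [set h : R | 0 < h^-1 *: ((df \o shift z) (h *: v) - df z)].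
  by apply: (c [set y | 0 < y]); apply: open_nbhs_nbhs; split => //; exact: open_gt.
pose s := Num.min e r / 2.
have m0 : 0 < Num.min e r by rewrite lt_min e0 r0.
have me : Num.min e r <= e by rewrite ge_min lexx.
have mr : Num.min e r <= r by rewrite ge_min lexx orbT.
have s0 : 0 < s by rewrite /s; lra.
have se : s < e by rewrite /s; lra.
have sr : s < r by rewrite /s; lra.
have dls (t : R) : t \in `[0, s] ->
    is_derive t (1 : R) (fun s : R => f (z + s *: v)) (df (z + t *: v)).
  rewrite in_itv/= => /andP[t0 ts]; apply: is_derive_line; apply: h.
  by rewrite ger0_norm//; lra.
have [t tI E] := @MVT R (fun s : R => f (z + s *: v))
  (fun s => df (z + s *: v)) 0 s s0
  (fun s sI => dls s (subset_itv_oo_cc sI))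
  (derivable_within_continuous (fun s sI => @ex_derive _ _ _ _ _ _ _ (dls s sI))).
move: tI; rewrite in_itv/= => /andP[t0 ts].
have : 0 < t^-1 *: ((df \o shift z) (t *: v) - df z).
  apply: he; last by rewrite gt_eqF.
  by rewrite /ball/= sub0r normrN gtr0_norm//; lra.
rewrite /= df0 subr0 /GRing.scale/= pmulr_rgt0 ?invr_gt0// addrC => dp.
have := hm s; rewrite gtr0_norm// => /(_ sr).
rewrite -subr_le0; move: E; rewrite scale0r addr0 subr0 => ->.
by rewrite leNgt mulr_gt0.
Qed.

(* The increment is split along the polygonal path that changes one coordinate
   at a time; it stays in the max-norm ball. *)
Lemma partial_bound_lipschitz f (D : 'I_n -> V -> R) z r (C : R) :
  (forall x i, `|x - z| < r -> is_derive x (evec R i) f (D i x)) ->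
  (forall x i, `|x - z| < r -> `|D i x| <= C) ->
  forall y, `|y - z| < r -> `|f y - f z| <= n%:R * C * `|y - z|.
Proof.
move=> h hC y yr.
pose w k : V := \row_j (if (j < k)%N then y 0 j else z 0 j).
have w0 : w 0 = z by apply/rowP => j; rewrite mxE ltn0.
have wn : w n = y by apply/rowP => j; rewrite mxE ltn_ord.
have wS (i : 'I_n) : w i.+1 = w i + (y 0 i - z 0 i) *: evec R i.
  apply/rowP => j; rewrite !mxE eqxx/= ltnS; case: (ltngtP j i) => // ij.
  - by rewrite (_ : (j == i) = false) ?mulr0 ?addr0//; apply/negbTE; rewrite -val_eqE/= ltn_eqF.
  - by rewrite (_ : (j == i) = false) ?mulr0 ?addr0//; apply/negbTE; rewrite -val_eqE/= gtn_eqF.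
  - have -> : j = i by exact: val_inj.
    by rewrite eqxx mulr1 addrCA subrr addr0.
have wb (i : 'I_n) (s : R) : `|s| <= `|y 0 i - z 0 i| -> `|w i + s *: evec R i - z| < r.
  move=> sb; apply: le_lt_trans yr; apply: norm_le_coord => // j.
  apply: le_trans (coord_le_norm (y - z) j).
  rewrite !mxE eqxx/=; case: (ltngtP j i) => // ij.
  - by rewrite (_ : (j == i) = false) ?mulr0 ?addr0//; apply/negbTE; rewrite -val_eqE/= ltn_eqF.
  - rewrite (_ : (j == i) = false) ?mulr0 ?addr0 ?subrr ?normr0//.
    by apply/negbTE; rewrite -val_eqE/= gtn_eqF.
  - have -> : j = i by exact: val_inj.
    by rewrite eqxx mulr1 addrAC subrr add0r.
have step (i : 'I_n) : `|f (w i.+1) - f (w i)| <= C * `|y - z|.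
  rewrite wS.
  have [s sb ->] := MVT_line (fun s sb => h _ i (wb i s sb)).
  rewrite normrM mulrC ler_pM//; first by apply: hC; exact: wb.
  by have := coord_le_norm (y - z) i; rewrite !mxE.
rewrite -{1}w0 -{1}wn.
have -> : f (w n) - f (w 0%N) = \sum_(i < n) (f (w i.+1) - f (w i)).
  by rewrite -(big_mkord xpredT (fun i => f (w i.+1) - f (w i))) telescope_sumr.
apply: le_trans (ler_norm_sum _ _ _) _.
apply: le_trans (ler_sum _ (fun i _ => step i)) _.
by rewrite sumr_const card_ord -mulrA mulr_natl.
Qed.

End Calculus.

(** * Derivative and continuity rules in pointwise form; the squared Euclidean distance *)

Section Rules.
Variables (R : realType) (n : nat).
Notation V := 'rV[R]_n.
Implicit Types (x y z v : V) (f g : V -> R).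

Lemma is_derive_add x v f g (a b : R) : is_derive x v f a -> is_derive x v g b ->
  is_derive x v (fun y => f y + g y) (a + b).
Proof. exact: is_deriveD. Qed.

Lemma is_derive_mul x v f g (a b : R) : is_derive x v f a -> is_derive x v g b ->
  is_derive x v (fun y => f y * g y) (f x * b + g x * a).
Proof. exact: is_deriveM. Qed.

Lemma is_derive_scal x v f (k a : R) : is_derive x v f a ->
  is_derive x v (fun y => k * f y) (k * a).
Proof. exact: is_deriveZ. Qed.

Lemma is_derive_const x v (k : R) : is_derive x v (fun=> k) 0.
Proof. exact: is_derive_cst. Qed.

Lemma is_derive_sqr x v f (a : R) : is_derive x v f a ->
  is_derive x v (fun y => f y ^+ 2) (2 * f x * a).
Proof.
by move=> h; apply: is_derive_eq (is_derive_mul h h) _; ring.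
Qed.

Lemma is_derive_bigsum m x v (h : 'I_m -> V -> R) (a : 'I_m -> R) :
  (forall i, is_derive x v (h i) (a i)) ->
  is_derive x v (fun y => \sum_(i < m) h i y) (\sum_(i < m) a i).
Proof.
move=> ha; have := is_derive_sum ha.
by congr (is_derive _ _ _ _); apply/funext => y; rewrite fct_sumE.
Qed.

Lemma continuous_add f g x : {for x, continuous f} -> {for x, continuous g} ->
  {for x, continuous (fun y => f y + g y)}.
Proof. exact: continuousD. Qed.

Lemma continuous_sub f g x : {for x, continuous f} -> {for x, continuous g} ->
  {for x, continuous (fun y => f y - g y)}.
Proof. exact: continuousB. Qed.

Lemma continuous_scal (k : R) f x : {for x, continuous f} ->
  {for x, continuous (fun y => k * f y)}.
Proof. by move=> c; apply: continuousM => //; exact: cst_continuous. Qed.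

Lemma continuous_sqr f x : {for x, continuous f} ->
  {for x, continuous (fun y => f y ^+ 2)}.
Proof. by move=> c; exact: (continuousM c c). Qed.

Lemma continuous_bigsum m (h : 'I_m -> V -> R) x :
  (forall i, {for x, continuous (h i)}) ->
  {for x, continuous (fun y => \sum_(i < m) h i y)}.
Proof. 
move=> c; rewrite /continuous_at.
by apply: (@cvg_big _ _ +%R 0 xpredT (@add_continuous _)) => [|i _]; [exact: nbhs_filter|exact: c].
Qed.

Lemma continuous_translate f x z : {for (x + z), continuous f} ->
  {for x, continuous (fun y => f (y + z))}.
Proof.
move=> cf; have c1 : continuous_at x (fun y : V => (y + z : V)).
  by apply: continuousD; [exact: cvg_id|exact: cst_continuous].
exact: (continuous_comp c1 cf).
Qed.

Lemma is_derive_translate x v z f (a : R) : is_derive (x + z) v f a ->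
  is_derive x v (fun y => f (y + z)) a.
Proof.
have E : (fun h : R => h^-1 *: ((f \o shift (x + z)) (h *: v) - f (x + z)))
  = (fun h : R => h^-1 *: (((fun y => f (y + z)) \o shift x) (h *: v) - f (x + z))).
  by apply/funext => h /=; congr (_ *: (f _ - _)); rewrite addrA.
by case=> d1 d2; split; [move: d1; rewrite /derivable E|rewrite /derive -E].
Qed.

Lemma is_derive_coord x v j : is_derive x v (fun y => y 0 j) (v 0 j).
Proof.
have c : (fun h : R => h^-1 *: (((fun y : V => y 0 j) \o shift x) (h *: v)
    - (fun y : V => y 0 j) x)) @ 0^' --> v 0 j.
  apply: cvg_near_cst; near=> h => /=.
  rewrite !mxE addrK /GRing.scale/= mulKf//.
  by near: h; exact: nbhs_dnbhs_neq.
split; [exact: (cvgP _ c)|exact: cvg_lim c].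
Unshelve. all: by end_near. Qed.

(** The topology comes from the max norm, which is not differentiable. Balls, penalties and barriers
    use this polynomial instead; [norm_le_sqdist] and [sqdist_le_norm] translate between the two. *)
Definition sqdist z y : R := \sum_(j < n) (y 0 j - z 0 j) ^+ 2.

Lemma sqdist_ge0 z y : 0 <= sqdist z y.
Proof. by apply: sumr_ge0 => j _; exact: sqr_ge0. Qed.

Lemma is_derive_coordB x z i j :
  is_derive x (evec R i) (fun y => y 0 j - z 0 j) (j == i)%:R.
Proof.
apply: is_derive_eq (is_derive_add (is_derive_coord _ _ _) (is_derive_const _ _ _)) _.
by rewrite addr0 evecE.
Qed.

Lemma is_derive_sqdist x z i :
  is_derive x (evec R i) (sqdist z) (2 * (x 0 i - z 0 i)).
Proof.
apply: (is_derive_eq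
  (is_derive_bigsum (fun j => is_derive_sqr (is_derive_coordB x z i j)))).
rewrite (bigD1 i)//= eqxx mulr1 big1 ?addr0// => j /negPf ->.
by rewrite mulr0.
Qed.

Lemma sqdist_continuous z : continuous (sqdist z).
Proof.
move=> x; apply: continuous_bigsum => j.
apply: continuous_sqr; apply: continuousB; [exact: coord_continuous|exact: cst_continuous].
Qed.

Lemma norm_le_sqdist z y : `|y - z| ^+ 2 <= sqdist z y.
Proof.
have h : `|y - z| <= Num.sqrt (sqdist z y).
  apply: norm_le_coord => [|j]; first exact: sqrtr_ge0.
  rewrite !mxE -sqrtr_sqr; apply: ler_wsqrtr.
  rewrite /sqdist (bigD1 j)//= lerDl.
  by apply: sumr_ge0 => k _; exact: sqr_ge0.
by rewrite -[leRHS]sqr_sqrtr ?sqdist_ge0// lerXn2r// nnegrE ?normr_ge0 ?sqrtr_ge0.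
Qed.

Lemma sqdist_le_norm z y : sqdist z y <= n%:R * `|y - z| ^+ 2.
Proof.
have -> : n%:R * `|y - z| ^+ 2 = \sum_(j < n) `|y - z| ^+ 2.
  by rewrite sumr_const card_ord mulr_natl.
apply: ler_sum => j _; rewrite -real_normK ?num_real// lerXn2r ?nnegrE//.
by have := coord_le_norm (y - z) j; rewrite !mxE.
Qed.

End Rules.

(** * Neighbourhoods, compactness, segments and connected components *)

Section Topology.
Variables (R : realType) (n : nat).
Notation V := 'rV[R]_n.
Implicit Types (x y z : V) (f : V -> R) (A N W : set V).

Lemma nbhs_norm_lt x A : nbhs x A ->
  exists2 r : R, 0 < r & forall y, `|y - x| < r -> A y.
Proof.
move=> /nbhs_ballP[r r0 h]; exists r => // y yr; apply: h.
by rewrite -ball_normE /ball_/= distrC.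
Qed.

Lemma norm_lt_nbhs x A (r : R) : 0 < r -> (forall y, `|y - x| < r -> A y) -> nbhs x A.
Proof.
move=> r0 h; apply/nbhs_ballP; exists r => // y.
by rewrite -ball_normE /ball_/= distrC; exact: h.
Qed.

Lemma open_norm_lt A x : open A -> A x ->
  exists2 r : R, 0 < r & forall y, `|y - x| < r -> A y.
Proof. by move=> oA Ax; apply: nbhs_norm_lt; exact: open_nbhs_nbhs. Qed.

Lemma open_of_norm_lt A :
  (forall x, A x -> exists2 r : R, 0 < r & forall y, `|y - x| < r -> A y) -> open A.
Proof.
by move=> h; rewrite openE => x /h[r r0 hr]; exact: (norm_lt_nbhs r0).
Qed.

Lemma closure_norm_lt A x : closure A x <->
  forall r : R, 0 < r -> exists2 y, A y & `|y - x| < r.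
Proof.
split=> [cA r r0|h B /nbhs_norm_lt[r r0 hr]].
  have [|y [Ay yr]] := cA [set y | `|y - x| < r]; first exact: (norm_lt_nbhs r0).
  by exists y.
by have [y Ay yr] := h r r0; exists y; split => //; exact: hr.
Qed.

Lemma within_closure_le f A x (a : R) : {within closure A, continuous f} ->
  (forall y, A y -> f y <= a) -> closure A x -> f x <= a.
Proof.
move=> /subspace_continuousP cf h cx; rewrite leNgt; apply/negP => ax.
have w : within (closure A) (nbhs x) (f @^-1` [set y | a < y]).
  apply: (cf x cx [set y | a < y]); apply: open_nbhs_nbhs; split => //; exact: open_gt.
have [y [Ay /= fy]] := cx _ w.
have := fy (subset_closure Ay); rewrite ltNge h//.
Qed.

Lemma continuous_closure_le f A x (a : R) : {for x, continuous f} ->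
  (forall y, A y -> f y <= a) -> closure A x -> f x <= a.
Proof.
move=> cf h cx; rewrite leNgt; apply/negP => ax.
have w : nbhs x (f @^-1` [set y | a < y]).
  apply: (cf [set y | a < y]); apply: open_nbhs_nbhs; split => //; exact: open_gt.
by have [y [Ay /=]] := cx _ w; rewrite ltNge h.
Qed.

Lemma closed_bounded_compact A z (r : R) :
  closed A -> (forall x, A x -> `|x - z| <= r) -> compact A.
Proof.
move=> cA h; apply: bounded_closed_compact => //.
exists (r + `|z|); split; first exact: num_real.
move=> M Mr x /h xr; apply: le_trans (ltW Mr).
by rewrite -[x in leLHS](subrK z); apply: le_trans (ler_normD _ _) _; rewrite lerD2r.
Qed.

Lemma within_compact_max f A : A !=set0 -> compact A -> {within A, continuous f} ->
  exists2 c, A c & forall x, A x -> f x <= f c.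
Proof.
move=> A0 cA cf; have [c] := EVT_max_rV A0 cA cf.
by rewrite inE => Ac h; exists c => // x Ax; apply: h; rewrite inE.
Qed.

Lemma within_of_for f A : (forall x, A x -> {for x, continuous f}) ->
  {within A, continuous f}.
Proof. by move=> h; apply: continuous_in_subspaceT => x; rewrite inE; exact: h. Qed.

(** The continuation argument used below for [Om], for [N] and for segments: an open set that is
    relatively closed in a connected set and meets it must cover it. *)
Lemma connected_clopen_sub A N x : connected A -> open N ->
  (forall y, A y -> closure N y -> N y) -> A x -> N x -> A `<=` N.
Proof.
move=> cA oN h Ax Nx.
have <- : A `&` N = A; last by move=> y [].
apply: cA; first by exists x.
- by exists N.
- exists (closure N); first exact: closed_closure.
  apply/seteqP; split => y [Ay Ny]; split => //; first exact: subset_closure.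
  exact: h.
Qed.

Definition segment_set x y : set V := [set x + t *: (y - x) | t in `[(0 : R), 1]].

Lemma segment_set_connected x y : connected (segment_set x y).
Proof.
apply: connected_continuous_connected; first exact: segment_connected.
apply: continuous_subspaceT => t; apply: cvgD; first exact: cvg_cst.
by apply: cvgZr_tmp; exact: cvg_id.
Qed.

Lemma segment_setl x y : segment_set x y x.
Proof. by exists 0; [rewrite /= in_itv/= lexx ler01|rewrite scale0r addr0]. Qed.

Lemma segment_setr x y : segment_set x y y.
Proof. by exists 1; [rewrite /= in_itv/= lexx ler01|rewrite scale1r addrC subrK]. Qed.

Lemma segment_set_norm x y z (r : R) : `|x - z| < r -> `|y - z| < r ->
  forall w, segment_set x y w -> `|w - z| < r.
Proof.
move=> xr yr w [t /=]; rewrite in_itv/= => /andP[t0 t1] <-.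
have -> : x + t *: (y - x) - z = (1 - t) *: (x - z) + t *: (y - z).
  by apply/rowP => j; rewrite !mxE; ring.
apply: le_lt_trans (ler_normD _ _) _.
rewrite !normrZ (ger0_norm t0) ger0_norm ?subr_ge0//.
have [->|tn] := eqVneq t 1; first by rewrite subrr mul0r add0r mul1r.
have t1' : t < 1 by rewrite lt_neqAle tn.
by nra.
Qed.

Lemma component_segment W N x y : components W N -> N x -> segment_set x y `<=` W -> N y.
Proof.
move=> [w Ww <-] Nx sW.
rewrite (same_connected_component Nx).
apply: (connected_component_max (segment_setl x y) sW (@segment_set_connected x y)).
exact: segment_setr.
Qed.

Lemma component_sub W N : components W N -> N `<=` W.
Proof. by move=> [w Ww <-]; exact: connected_component_sub. Qed.

Lemma component_nonempty W N : components W N -> N !=set0.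
Proof. by move=> [w Ww <-]; exists w; exact: connected_component_refl. Qed.

Lemma component_open W N : open W -> components W N -> open N.
Proof.
move=> oW cN; apply: open_of_norm_lt => x Nx.
have [r r0 hr] := open_norm_lt oW (component_sub cN Nx).
exists r => // y yr; apply: (component_segment cN Nx) => w sw.
apply: hr; apply: segment_set_norm sw => //.
by rewrite subrr normr0.
Qed.

(** A ball around [x] inside [W] meets [N], and the segment from a point of [N] to [x] stays in that
    ball, hence in the same component. *)
Lemma component_rel_closed W N x : open W -> components W N ->
  W x -> closure N x -> N x.
Proof.
move=> oW cN Wx /closure_norm_lt cx.
have [r r0 hr] := open_norm_lt oW Wx.
have [y Ny yr] := cx r r0; apply: (component_segment cN Ny) => w sw.
apply: hr; apply: segment_set_norm sw => //.
by rewrite subrr normr0.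
Qed.

End Topology.

(** * The P-function, its differential inequality in viscosity form, and Hopf's lemma *)

Section PFunction.
Variables (R : realType) (n : nat).
Notation V := 'rV[R]_n.
Implicit Types (x y z p : V).
Variables (Om : set V) (u : V -> R) (g : 'I_n -> V -> R) (H : 'I_n -> 'I_n -> V -> R).
Hypothesis Om_open : open Om.
Hypothesis der_u : forall x, Om x -> forall i, is_derive x (evec R i) u (g i x).
Hypothesis der_g : forall x, Om x -> forall i j, is_derive x (evec R j) (g i) (H i j x).
Hypothesis cont_u : forall x, Om x -> {for x, continuous u}.
Hypothesis cont_g : forall x, Om x -> forall i, {for x, continuous (g i)}.
Hypothesis cont_H : forall x, Om x -> forall i j, {for x, continuous (H i j)}.
Hypothesis lap_u : forall x, Om x -> \sum_(i < n) H i i x = - n%:R.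

Definition Pfunc (x : V) : R := \sum_(i < n) g i x ^+ 2 + 2 * u x.

(** The value that [Lap Pfunc] takes when [u] has third derivatives: the terms pairing the gradient
    of [u] with that of [Lap u] drop out, and [2 * Lap u = - 2 * n]. *)
Definition hess_defect (x : V) : R :=
  2 * (\sum_(j < n) \sum_(i < n) H j i x ^+ 2) - 2 * n%:R.

Lemma Pfun_continuous x : Om x -> {for x, continuous Pfunc}.
Proof.
move=> Ox; apply: continuousD.
  by apply: continuous_bigsum => i; apply: continuous_sqr; exact: cont_g.
by apply: continuousM; [exact: cst_continuous|exact: cont_u].
Qed.

Definition fwd_diff (t : R) (f : V -> R) (i : 'I_n) (x : V) : R :=
  t^-1 * (f (x + t *: evec R i) - f x).

(** Difference quotients commute with partial derivatives ([is_derive_fwd_diff]), so two derivatives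
    of this function involve only two derivatives of [u]. *)
Definition Pfun_diff (t : R) (x : V) : R :=
  \sum_(i < n) fwd_diff t u i x ^+ 2 + 2 * u x.

Lemma is_derive_fwd_diff t f (df : V -> R) i x v :
  is_derive (x + t *: evec R i) v f (df (x + t *: evec R i)) ->
  is_derive x v f (df x) ->
  is_derive x v (fwd_diff t f i) (fwd_diff t df i x).
Proof.
move=> d1 d2; apply: is_derive_scal.
exact: is_deriveB (is_derive_translate d1) d2.
Qed.

Lemma fwd_diff_mvt t f (df : V -> R) i x : 0 < t ->
  (forall s, `|s| <= t ->
     is_derive (x + s *: evec R i) (evec R i) f (df (x + s *: evec R i))) ->
  exists2 s, `|s| <= t & fwd_diff t f i x = df (x + s *: evec R i).
Proof.
move=> t0 h; have [|s st E] := @MVT_line R n f df x (evec R i) t.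
  by move=> s; rewrite (gtr0_norm t0); exact: h.
exists s; first by rewrite -(gtr0_norm t0).
by rewrite /fwd_diff E mulKf// gt_eqF.
Qed.

Lemma near_continuous_gt (f : V -> R) x a : {for x, continuous f} -> a < f x ->
  nbhs x [set y | a < f y].
Proof.
move=> c ax; apply: (c [set y | a < y]).
by apply: open_nbhs_nbhs; split => //; exact: open_gt.
Qed.

Lemma near_continuous_bounded (f : V -> R) x : {for x, continuous f} ->
  nbhs x [set y | `|f y| <= `|f x| + 1].
Proof.
move=> c.
have c1 : {for x, continuous (fun y => - `|f y|)}.
  apply: continuousN; apply: (continuous_comp c); exact: norm_continuous.
have := near_continuous_gt (a := - (`|f x| + 1)) c1.
rewrite ltrN2 ltrDl ltr01 => /(_ isT); apply: filterS => y /=.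
by rewrite ltrN2 => /ltW.
Qed.

Lemma local_C2_bounds z : Om z -> exists r C : R, [/\ 0 < r, 0 <= C &
  forall y, `|y - z| < r -> [/\ Om y, forall i, `|g i y| <= C &
    forall i j, `|H i j y| <= C]].
Proof.
move=> Oz.
(* A sum of nonnegative bounds dominates each of them, so it serves as a common bound. *)
pose C := \sum_i (`|g i z| + 1) + \sum_i \sum_j (`|H i j z| + 1).
have g0 i : 0 <= `|g i z| + 1 by rewrite addr_ge0.
have H0 i j : 0 <= `|H i j z| + 1 by rewrite addr_ge0.
have sg0 : 0 <= \sum_i (`|g i z| + 1) by apply: sumr_ge0.
have sH0 : 0 <= \sum_i \sum_j (`|H i j z| + 1).
  by apply: sumr_ge0 => i _; apply: sumr_ge0.
have gC i : `|g i z| + 1 <= C.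
  rewrite /C (bigD1 i)//= -addrA lerDl addr_ge0//; exact: sumr_ge0.
have HC i j : `|H i j z| + 1 <= C.
  rewrite /C; apply: le_trans (ler_wpDl sg0 (lexx _)).
  rewrite (bigD1 i)//= (bigD1 j)//= -addrA lerDl addr_ge0//; first exact: sumr_ge0.
  by apply: sumr_ge0 => k _; exact: sumr_ge0.
have [r r0 h] : exists2 r : R, 0 < r & forall y, `|y - z| < r ->
   (Om `&` ([set y | forall i, `|g i y| <= `|g i z| + 1] `&`
   [set y | forall i j, `|H i j y| <= `|H i j z| + 1])) y.
  apply: nbhs_norm_lt; apply: filterI; first exact: open_nbhs_nbhs.
  apply: filterI.
    apply: (@filter_forall _ _ (fun i => [set y | `|g i y| <= `|g i z| + 1]) _ (nbhs_filter z)) => i.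
    by apply: near_continuous_bounded; exact: cont_g.
  apply: (@filter_forall _ _ (fun i => [set y | forall j, `|H i j y| <= `|H i j z| + 1])
    _ (nbhs_filter z)) => i.
  apply: (@filter_forall _ _ (fun j => [set y | `|H i j y| <= `|H i j z| + 1])
    _ (nbhs_filter z)) => j.
  by apply: near_continuous_bounded; exact: cont_H.
exists r, C; split => //; first exact: addr_ge0.
move=> y /h[Oy [gy Hy]]; split => // [i|i j]; first exact: le_trans (gC i).
exact: le_trans (HC i j).
Qed.

(** The mean value theorem turns the quotient into [g i] at a shifted point, and a second use bounds
    the change of [g i] by [C * t']. Factoring the difference of squares contributes a further
    [2 * C] per coordinate. *)
Lemma Pfun_diff_approx z r C t x : 0 < t -> 2 * t < r -> `|x - z| <= t ->
  (forall y, `|y - z| < r -> [/\ Om y, forall i, `|g i y| <= C &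
    forall i j, `|H i j y| <= C]) -> forall t', 0 < t' -> t' <= t ->
  `|Pfun_diff t' x - Pfunc x| <= n%:R * (2 * C * C) * t'.
Proof.
move=> t0 tr xz hr t' t'0 t't.
have xs i s : `|s| <= t' -> `|x + s *: evec R i - z| < r.
  move=> st; rewrite addrAC; apply: le_lt_trans (ler_normD _ _) _.
  by have := norm_scale_evec s i; lra.
rewrite /Pfun_diff /Pfunc opprD addrACA subrr addr0 -sumrB.
apply: le_trans (ler_norm_sum _ _ _) _.
have -> : n%:R * (2 * C * C) * t' = \sum_(i < n) (2 * C * C * t').
  by rewrite sumr_const card_ord -mulrA mulr_natl.
apply: ler_sum => i _.
have C0 : 0 <= C.
  by have [_ /(_ i) h _] := hr z (ltac:(rewrite subrr normr0; lra)); apply: le_trans h.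
have [s st ->] := fwd_diff_mvt t'0 (fun s st => der_u (let: And3 o _ _ := hr _ (xs i s st) in o) i).
have [s' s's E] := MVT_line (t := s) (fun s' s's =>
  der_g (let: And3 o _ _ := hr _ (xs i s' (le_trans s's st)) in o) i i).
rewrite subr_sqr E !normrM.
have [_ _ /(_ i i) h1] := hr _ (xs i s' (le_trans s's st)).
have [_ /(_ i) h2 _] := hr _ (xs i s st).
have [_ /(_ i) h3 _] := hr x (ltac:(lra)).
have h4 := ler_normD (g i (x + s *: evec R i)) (g i x).
have -> : 2 * C * C * t' = t' * C * (2 * C) by ring.
apply: ler_pM => //; [by apply: ler_pM|lra].
Qed.

Lemma is_derive_Pfun_diff t x j : Om x -> (forall i, Om (x + t *: evec R i)) ->
  is_derive x (evec R j) (Pfun_diff t)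
    (\sum_(i < n) 2 * (fwd_diff t u i x * fwd_diff t (g j) i x) + 2 * g j x).
Proof.
move=> Ox Ot; apply: is_derive_add; last by apply: is_derive_scal; exact: der_u.
apply: is_derive_bigsum => i.
apply: is_derive_eq (is_derive_sqr (is_derive_fwd_diff (df := g j) _ _)) _.
- exact: der_u.
- exact: der_u.
- by rewrite mulrA.
Qed.

Lemma is_derive2_Pfun_diff t x j : Om x -> (forall i, Om (x + t *: evec R i)) ->
  is_derive x (evec R j)
    (fun x => \sum_(i < n) 2 * (fwd_diff t u i x * fwd_diff t (g j) i x) + 2 * g j x)
    (\sum_(i < n) 2 * (fwd_diff t u i x * fwd_diff t (H j j) i x
                       + fwd_diff t (g j) i x * fwd_diff t (g j) i x)
     + 2 * H j j x).
Proof.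
move=> Ox Ot; apply: is_derive_add; last by apply: is_derive_scal; exact: der_g.
apply: is_derive_bigsum => i; apply: is_derive_scal.
by apply: is_derive_mul; apply: is_derive_fwd_diff; (exact: der_u || exact: der_g).
Qed.

(** The cancellation is exact for each [t]: summed over [j], the quotients of [H j j] form the
    quotient of [Lap u], which is zero because [Lap u] equals [- n] at both points. *)
Lemma laplacian_Pfun_diff t x : Om x -> (forall i, Om (x + t *: evec R i)) ->
  \sum_(j < n) (\sum_(i < n) 2 * (fwd_diff t u i x * fwd_diff t (H j j) i x
                       + fwd_diff t (g j) i x * fwd_diff t (g j) i x)
     + 2 * H j j x)
  = 2 * (\sum_(j < n) \sum_(i < n) fwd_diff t (g j) i x ^+ 2) - 2 * n%:R.
Proof.
move=> Ox Ot; rewrite big_split/= -mulr_sumr lap_u// mulrN; congr (_ - _).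
have -> : \sum_(j < n) \sum_(i < n) 2 * (fwd_diff t u i x * fwd_diff t (H j j) i x
                       + fwd_diff t (g j) i x * fwd_diff t (g j) i x)
  = \sum_(j < n) \sum_(i < n) 2 * (fwd_diff t u i x * fwd_diff t (H j j) i x)
  + \sum_(j < n) \sum_(i < n) 2 * fwd_diff t (g j) i x ^+ 2.
  rewrite -big_split/=; apply: eq_bigr => j _; rewrite -big_split/=.
  by apply: eq_bigr => i _; rewrite mulrDr expr2.
rewrite exchange_big/= big1 ?add0r => [|i _].
  rewrite mulr_sumr; apply: eq_bigr => j _; by rewrite mulr_sumr.
rewrite -mulr_sumr -mulr_sumr.
have -> : \sum_(j < n) fwd_diff t (H j j) i x = 0.
  by rewrite /fwd_diff -mulr_sumr sumrB !lap_u// subrr mulr0.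
by rewrite !mulr0.
Qed.

(* [Pfunc] is only C^1, so the inequality [Lap Pfunc >= hess_defect] is tested
   against smooth functions touching from above; it is obtained from the C^2
   approximations [Pfun_diff t]. *)
Lemma viscosity_strict z (phi : V -> R) (phi1 phi2 : 'I_n -> V -> R) eps r :
  Om z -> 0 < eps -> 0 < r ->
  continuous phi ->
  (forall x i, is_derive x (evec R i) phi (phi1 i x)) ->
  (forall x i, is_derive x (evec R i) (phi1 i) (phi2 i x)) ->
  (forall i, {for z, continuous (phi2 i)}) ->
  (forall y, `|y - z| < r -> Pfunc y + phi y + eps * `|y - z| ^+ 2 <= Pfunc z + phi z) ->
  hess_defect z + \sum_(i < n) phi2 i z <= 0.
Proof.
move=> Oz e0 r0 cphi dphi dphi1 cphi2 hm; rewrite leNgt; apply/negP => S0.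
set S := hess_defect z + _ in S0.
have n0 : 0 <= n%:R :> R by [].
(* The tolerance allowed for each of the [n * n] squared Hessian entries, which count twice, and for
   each of the [n] second derivatives of [phi]; the total loss stays below [S]. *)
pose eta := S / (2 * n%:R * n%:R + n%:R + 1).
have D0 : 0 < 2 * n%:R * n%:R + n%:R + 1 :> R by nra.
have eta0 : 0 < eta by rewrite divr_gt0.
have etaS : 2 * (n%:R * (n%:R * eta)) + n%:R * eta < S.
  have -> : S = eta * (2 * n%:R * n%:R + n%:R + 1) by rewrite /eta divfK// gt_eqF.
  by nra.
have [r1 r10 h1] : exists2 r : R, 0 < r & forall y, `|y - z| < r ->
   ([set y | forall i j, H i j z ^+ 2 - eta < H i j y ^+ 2] `&`
    [set y | forall i, phi2 i z - eta < phi2 i y]) y.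
  apply: nbhs_norm_lt; apply: filterI.
    apply: (@filter_forall _ _ (fun i => [set y | forall j, _]) _ (nbhs_filter z)) => i.
    apply: (@filter_forall _ _ (fun j => [set y | _]) _ (nbhs_filter z)) => j.
    apply: near_continuous_gt; last by rewrite ltrBlDr ltrDl.
    by apply: continuous_sqr; exact: cont_H.
  apply: (@filter_forall _ _ (fun i => [set y | _]) _ (nbhs_filter z)) => i.
  by apply: near_continuous_gt; [exact: cphi2|rewrite ltrBlDr ltrDl].
have [r2 [C [r20 C0 h2]]] := local_C2_bounds Oz.
pose m := Num.min r (Num.min r1 r2).
have m0 : 0 < m by rewrite !lt_min r0 r10 r20.
have mr : m <= r by rewrite /m ge_min lexx.
have mr1 : m <= r1 by rewrite /m !ge_min lexx !orbT.
have mr2 : m <= r2 by rewrite /m !ge_min lexx !orbT.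
pose rho := m / 3.
have rho0 : 0 < rho by rewrite /rho; lra.
have rhom : 2 * rho < m by rewrite /rho; lra.
pose K := n%:R * (2 * C * C).
have K0 : 0 <= K by rewrite /K !mulr_ge0.
(* The approximation error [K * t] occurs once at [z] and once at the competing point. Keeping
   [2 * K * t] below [eps * rho ^+ 2], the gap left by the penalty at distance [rho], forces the
   maximum of [w] into the interior. *)
pose t0 := eps * rho ^+ 2 / (2 * K + 1).
have er0 : 0 < eps * rho ^+ 2 by rewrite mulr_gt0// exprn_gt0.
have t00 : 0 < t0 by rewrite divr_gt0//; lra.
pose t := Num.min rho t0.
have t0' : 0 < t by rewrite lt_min rho0.
have trho : t <= rho by rewrite ge_min lexx.
have Kt : 2 * K * t < eps * rho ^+ 2.
  have tt0 : t <= t0 by rewrite ge_min lexx orbT.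
  have E : eps * rho ^+ 2 = t0 * (2 * K + 1) by rewrite /t0 divfK// gt_eqF//; lra.
  by rewrite E; nra.
pose w x := Pfun_diff t x + phi x.
have apx x : `|x - z| <= rho -> `|Pfun_diff t x - Pfunc x| <= K * t.
  by move=> xz; apply: (@Pfun_diff_approx z r2 C rho) => //; lra.
have xs x i s : `|x - z| <= rho -> `|s| <= rho -> `|x + s *: evec R i - z| < m.
  move=> xz st; rewrite addrAC; apply: le_lt_trans (ler_normD _ _) _.
  by have := norm_scale_evec s i; lra.
have Om_in x : `|x - z| <= rho -> Om x.
  by move=> xz; have [] := h2 x (ltac:(lra)).
have Om_sh x i s : `|x - z| <= rho -> `|s| <= rho -> Om (x + s *: evec R i).
  by move=> xz st; have [] := h2 _ (lt_le_trans (xs x i s xz st) mr2).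
have tn : `|t| <= rho by rewrite gtr0_norm.
have cw x : `|x - z| <= rho -> {for x, continuous w}.
  move=> xz; apply: continuousD; last exact: cphi.
  apply: continuousD; last first.
    by apply: continuousM; [exact: cst_continuous|apply: cont_u; exact: Om_in].
  apply: continuous_bigsum => i; apply: continuous_sqr.
  apply: continuousM; first exact: cst_continuous.
  apply: continuousB; last by apply: cont_u; exact: Om_in.
  by apply: continuous_translate; apply: cont_u; exact: Om_sh.
pose B : set V := [set x | `|x - z| <= rho].
have B0 : B !=set0 by exists z; rewrite /B/= subrr normr0 ltW.
have cB : closed B.
  apply: (@closed_comp _ _ (fun x : V => `|x - z|) [set y | y <= rho]); last exact: closed_le.
  by move=> x _; apply: (@continuous_translate _ _ Num.norm); exact: norm_continuous.
have [x Bx hx] := within_compact_max B0 (closed_bounded_compact cB (fun x Bx => Bx))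
  (within_of_for (fun x Bx => cw x Bx)).
have Bz : B z by rewrite /B/= subrr normr0 ltW.
have xlt : `|x - z| < rho.
  rewrite lt_neqAle Bx andbT; apply/eqP => xrho.
  have := hx z Bz; rewrite /w.
  have := apx z Bz; have := apx x Bx; have := hm x (ltac:(lra)).
  by rewrite xrho !ler_norml; lra.
pose r3 := rho - `|x - z|.
have r30 : 0 < r3 by rewrite subr_gt0.
have near_x s i : `|s| < r3 -> `|x + s *: evec R i - z| <= rho.
  move=> sr; rewrite addrAC; apply: le_trans (ler_normD _ _) _.
  by have := norm_scale_evec s i; rewrite /r3 in sr; lra.
have Ox := Om_in x Bx.
have Oxt i : Om (x + t *: evec R i) by exact: Om_sh.
(* The second derivative test at the interior maximum [x], one direction at a time; summing over [j]
   gives a nonpositive Laplacian. What remains is to show that this Laplacian is positive. *)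
have d2 j := @derive2_local_max R n w _ x (evec R j) r3 _ r30
  (fun s sr => is_derive_add
     (is_derive_Pfun_diff (t := t) j (Om_in _ (near_x s j sr)) (fun i => Om_sh _ i t (near_x s j sr) tn))
     (dphi (x + s *: evec R j) j))
  (is_derive_add (is_derive2_Pfun_diff (t := t) j Ox Oxt) (dphi1 x j))
  (fun s sr => hx _ (near_x s j sr)).
have := ler_sum (index_enum _) (fun j (_ : xpredT j) => d2 j).
rewrite big_split/= laplacian_Pfun_diff// big1_eq leNgt => /negP; apply.
(* By the mean value theorem the quotient is a value of [H j i] near [z], so continuity of the
   Hessian suffices. *)
have hH j i : H j i z ^+ 2 - eta <= fwd_diff t (g j) i x ^+ 2.
  have [s st ->] := fwd_diff_mvt t0' (fun s st => der_g (Om_sh x i s Bx (le_trans st trho)) j i).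
  have [h _] := h1 _ (lt_le_trans (xs x i s Bx (le_trans st trho)) mr1).
  exact/ltW/h.
have hS : \sum_(j < n) \sum_(i < n) H j i z ^+ 2 - n%:R * (n%:R * eta)
    <= \sum_(j < n) \sum_(i < n) fwd_diff t (g j) i x ^+ 2.
  have -> : n%:R * (n%:R * eta) = \sum_(j < n) \sum_(i < n) eta.
    by rewrite !sumr_const !card_ord !mulr_natl.
  rewrite -sumrB; apply: ler_sum => j _; rewrite -sumrB; apply: ler_sum => i _.
  exact: hH.
have hp : \sum_(i < n) phi2 i z - n%:R * eta <= \sum_(i < n) phi2 i x.
  have -> : n%:R * eta = \sum_(i < n) eta by rewrite sumr_const card_ord mulr_natl.
  rewrite -sumrB; apply: ler_sum => i _.
  by have [_ h] := h1 x (ltac:(lra)); exact/ltW/h.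
move: etaS; rewrite /S /hess_defect; lra.
Qed.

(** The strictness is bought by replacing [phi] with [phi - eps * sqdist z], which dominates the
    max-norm penalty by [norm_le_sqdist] and changes the Laplacian by only [2 * eps * n]; [eps] is
    arbitrary. *)
Lemma viscosity z (phi : V -> R) (phi1 phi2 : 'I_n -> V -> R) r :
  Om z -> 0 < r ->
  continuous phi ->
  (forall x i, is_derive x (evec R i) phi (phi1 i x)) ->
  (forall x i, is_derive x (evec R i) (phi1 i) (phi2 i x)) ->
  (forall i, {for z, continuous (phi2 i)}) ->
  (forall y, `|y - z| < r -> Pfunc y + phi y <= Pfunc z + phi z) ->
  hess_defect z + \sum_(i < n) phi2 i z <= 0.
Proof.
move=> Oz r0 cphi dphi dphi1 cphi2 hm.
apply/ler_addgt0Pr => d d0.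
pose eps := d / (2 * n%:R + 1).
have n0 : 0 <= n%:R :> R by [].
have D0 : 0 < 2 * n%:R + 1 :> R by lra.
have e0 : 0 < eps by rewrite divr_gt0.
have ed : d = eps * (2 * n%:R + 1) by rewrite /eps divfK// gt_eqF.
have := @viscosity_strict z (fun y => phi y + - eps * sqdist z y)
  (fun i y => phi1 i y + - eps * (2 * (y 0 i - z 0 i)))
  (fun i y => phi2 i y + - eps * (2 * 1)) eps r Oz e0 r0.
have -> : \sum_(i < n) (phi2 i z + - eps * (2 * 1)) = \sum_i phi2 i z - 2 * eps * n%:R.
  by rewrite big_split/= sumr_const card_ord -mulr_natr; congr (_ + _); ring.
move=> h; suff : hess_defect z + (\sum_i phi2 i z - 2 * eps * n%:R) <= 0 by rewrite ed; lra.
apply: h.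
- move=> x; apply: continuous_add; first exact: cphi.
  by apply: continuous_scal; exact: sqdist_continuous.
- move=> x i; apply: is_derive_add => //.
  by apply: is_derive_scal; exact: is_derive_sqdist.
- move=> x i; apply: is_derive_add => //; apply: is_derive_scal; apply: is_derive_scal.
  by have := is_derive_coordB x z i i; rewrite eqxx.
- by move=> i; apply: continuousD; [exact: cphi2|exact: cst_continuous].
- move=> y /hm; have := norm_le_sqdist z y.
  have -> : sqdist z z = 0 by rewrite /sqdist big1// => j _; rewrite subrr expr0n.
  by nra.
Qed.
(** Since the trace of [H] is [- n], [|H + I|^2 = |H|^2 - 2 n + n]. The sum of squares yields both
    the sign and the equality case. *)
Lemma hess_defectE x : Om x ->
  hess_defect x = 2 * \sum_(j < n) \sum_(i < n) (H j i x + (j == i)%:R) ^+ 2.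
Proof.
move=> Ox; rewrite /hess_defect -mulrBr; congr (2 * _).
have -> : \sum_(j < n) \sum_(i < n) (H j i x + (j == i)%:R) ^+ 2
  = \sum_(j < n) (\sum_(i < n) H j i x ^+ 2 + (2 * H j j x + 1)).
  apply: eq_bigr => j _.
  have -> : 2 * H j j x + 1 = \sum_(i < n) (2 * (H j i x * (j == i)%:R) + (j == i)%:R).
    rewrite (bigD1 j)//= eqxx mulr1 big1 ?addr0// => i /negPf ij.
    by rewrite eq_sym ij mulr0 mulr0 addr0.
  rewrite -big_split/=; apply: eq_bigr => i _.
  by case: eqP => _ /=; ring.
rewrite big_split/= big_split/= -mulr_sumr lap_u// sumr_const card_ord.
by rewrite mulrN mulr_natl; congr (_ + _); ring.
Qed.

Lemma hess_defect_ge0 x : Om x -> 0 <= hess_defect x.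
Proof.
move=> Ox; rewrite hess_defectE// mulr_ge0//; apply: sumr_ge0 => j _.
by apply: sumr_ge0 => i _; exact: sqr_ge0.
Qed.

Lemma hess_defect_le0 x : Om x -> hess_defect x <= 0 ->
  forall j i, H j i x = - (j == i)%:R.
Proof.
move=> Ox; rewrite hess_defectE// pmulr_rle0// => h j i.
have s0 j' : 0 <= \sum_(i < n) (H j' i x + (j' == i)%:R) ^+ 2.
  by apply: sumr_ge0 => k _; exact: sqr_ge0.
have : (H j i x + (j == i)%:R) ^+ 2 <= 0.
  apply: le_trans h; rewrite (bigD1 j)//= (bigD1 i)//= -addrA lerDl.
  by apply: addr_ge0; apply: sumr_ge0 => // k _; exact: sqr_ge0.
move=> h0; apply/eqP; rewrite -addr_eq0 -sqrf_eq0 eq_le h0/=.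
exact: sqr_ge0.
Qed.

Definition Pfun_grad (i : 'I_n) (x : V) : R :=
  \sum_(j < n) 2 * (g j x * H j i x) + 2 * g i x.

Lemma is_derive_Pfun x i : Om x -> is_derive x (evec R i) Pfunc (Pfun_grad i x).
Proof.
move=> Ox; apply: is_derive_add; last by apply: is_derive_scal; exact: der_u.
apply: is_derive_bigsum => j.
by apply: is_derive_eq (is_derive_sqr (der_g Ox j i)) _; rewrite mulrA.
Qed.

Lemma Pfun_grad_continuous x i : Om x -> {for x, continuous (Pfun_grad i)}.
Proof.
move=> Ox; apply: continuous_add; last by apply: continuous_scal; exact: cont_g.
apply: continuous_bigsum => j; apply: continuous_scal.
by apply: continuousM; [exact: cont_g|exact: cont_H].
Qed.

Lemma Pfun_grad_local_max x r : 0 < r ->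
  (forall y, `|y - x| < r -> Om y /\ Pfunc y <= Pfunc x) ->
  forall i, Pfun_grad i x = 0.
Proof.
move=> r0 h i.
have xs s : `|s| < r -> `|x + s *: evec R i - x| < r.
  by move=> sr; rewrite addrAC subrr add0r; apply: le_lt_trans sr; exact: norm_scale_evec.
apply: (@derive_local_max R n Pfunc (Pfun_grad i) x (evec R i) r) => // s sr.
  by apply: is_derive_Pfun; have [] := h _ (xs s sr).
by have [] := h _ (xs s sr).
Qed.

(* Replaces the usual exponential barrier of Hopf's lemma: with [K = n / s0]
   its Laplacian is positive as soon as [sqdist x0 y >= s0 (1 - 1 / (4 n))]. *)
Definition barrier (x0 : V) (s0 K : R) (y : V) : R :=
  s0 - sqdist x0 y + K * (s0 - sqdist x0 y) ^+ 2.

Definition barrier1 (x0 : V) (s0 K : R) (i : 'I_n) (y : V) : R :=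
  - (1 + 2 * K * (s0 - sqdist x0 y)) * (2 * (y 0 i - x0 0 i)).

Definition barrier2 (x0 : V) (s0 K : R) (i : 'I_n) (y : V) : R :=
  8 * K * (y 0 i - x0 0 i) ^+ 2 - 2 * (1 + 2 * K * (s0 - sqdist x0 y)).

Lemma is_derive_sub_sqdist (x0 : V) s0 y i :
  is_derive y (evec R i) (fun y => s0 - sqdist x0 y) (- (2 * (y 0 i - x0 0 i))).
Proof.
apply: is_derive_eq (is_deriveB (is_derive_const y (evec R i) s0)
  (is_derive_sqdist y x0 i)) _.
by rewrite sub0r.
Qed.

Lemma is_derive_barrier (x0 : V) s0 K y i :
  is_derive y (evec R i) (barrier x0 s0 K) (barrier1 x0 s0 K i y).
Proof.
apply: is_derive_eq (is_derive_add (is_derive_sub_sqdist x0 s0 y i)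
  (is_derive_scal K (is_derive_sqr (is_derive_sub_sqdist x0 s0 y i)))) _.
by rewrite /barrier1; ring.
Qed.

Lemma is_derive_barrier1 (x0 : V) s0 K y i :
  is_derive y (evec R i) (barrier1 x0 s0 K i) (barrier2 x0 s0 K i y).
Proof.
have d1 : is_derive y (evec R i) (fun y => - (1 + 2 * K * (s0 - sqdist x0 y)))
    (4 * K * (y 0 i - x0 0 i)).
  apply: is_derive_eq (is_deriveN (is_derive_add (is_derive_const y (evec R i) 1)
    (is_derive_scal (2 * K) (is_derive_sub_sqdist x0 s0 y i)))) _.
  by ring.
have d2 := is_derive_scal 2 (is_derive_coordB y x0 i i).
apply: is_derive_eq (is_derive_mul d1 d2) _.
by rewrite /barrier2 eqxx /=; ring.
Qed.

Lemma barrier_continuous x0 s0 K : continuous (barrier (x0 : V) s0 K).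
Proof.
move=> x; have c : {for x, continuous (fun y => s0 - sqdist x0 y)}.
  by apply: continuous_sub; [exact: cst_continuous|exact: sqdist_continuous].
by apply: continuous_add => //; apply: continuous_scal; exact: continuous_sqr.
Qed.

Lemma barrier2_continuous x0 s0 K i : continuous (barrier2 (x0 : V) s0 K i).
Proof.
move=> x; have c : {for x, continuous (fun y => s0 - sqdist x0 y)}.
  by apply: continuous_sub; [exact: cst_continuous|exact: sqdist_continuous].
apply: continuous_sub.
  apply: continuous_scal; apply: continuous_sqr.
  by apply: continuous_sub; [exact: coord_continuous|exact: cst_continuous].
apply: continuous_scal; apply: continuous_add; first exact: cst_continuous.
exact: continuous_scal.
Qed.

Lemma sum_barrier2 (x0 : V) s0 K y :
  \sum_(i < n) barrier2 x0 s0 K i y =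
  8 * K * sqdist x0 y - 2 * n%:R * (1 + 2 * K * (s0 - sqdist x0 y)).
Proof.
rewrite /barrier2 sumrB -mulr_sumr sumr_const card_ord -mulr_natl.
by congr (_ - _); ring.
Qed.

Lemma sqdist_closed_le z (s : R) : closed [set x | sqdist z x <= s].
Proof.
apply: (@closed_comp _ _ (sqdist z) [set y | y <= s]); last exact: closed_le.
by move=> x _; exact: sqdist_continuous.
Qed.

Lemma sqdist_closed_ge z (s : R) : closed [set x | s <= sqdist z x].
Proof.
apply: (@closed_comp _ _ (sqdist z) [set y | s <= y]); last exact: closed_ge.
by move=> x _; exact: sqdist_continuous.
Qed.

Lemma norm_le_of_sqdist_le z x (s : R) : sqdist z x <= s -> `|x - z| <= s + 1.
Proof.
move=> h; have := norm_le_sqdist z x; have := normr_ge0 (x - z).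
move: (`|x - z|) => a a0 a2; nra.
Qed.

(** A multiple of the barrier can be added to [Pfunc] on an annulus without exceeding [M]. The
    barrier grows linearly on the way from [p] to [x0], so [Pfunc] would have to drop linearly,
    which its vanishing gradient at [p] forbids. *)
Lemma hopf (x0 p : V) (s0 M : R) : (0 < n)%N -> 0 < s0 ->
  (forall x, sqdist x0 x <= s0 -> Om x /\ Pfunc x <= M) ->
  (forall x, sqdist x0 x < s0 -> Pfunc x < M) ->
  sqdist x0 p = s0 -> Pfunc p = M -> (forall i, Pfun_grad i p = 0) -> False.
Proof.
move=> n0 s00 hO hlt sp Pp gp.
have n1 : 1 <= n%:R :> R by rewrite ler1n.
pose th : R := (4 * n%:R)^-1.
have thn : 4 * n%:R * th = 1 by rewrite /th divff// gt_eqF//; lra.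
have th0 : 0 < th by rewrite invr_gt0; lra.
have th1 : th <= 4^-1 by nra.
pose s1 := s0 * (1 - th).
have s1s0 : s1 < s0 by rewrite /s1; nra.
have s10 : 0 < s1 by rewrite /s1; nra.
pose K := n%:R / s0.
have Ks : K * s0 = n%:R by rewrite /K divfK// gt_eqF.
have K0 : 0 < K by rewrite /K divr_gt0//; lra.
pose Bin : set V := [set x | sqdist x0 x <= s1].
have [c Bc hc] : exists2 c, Bin c & forall x, Bin x -> Pfunc x <= Pfunc c.
  apply: within_compact_max.
  - exists x0; rewrite /Bin/= /sqdist big1 => [|j _]; first exact: ltW.
    by rewrite subrr expr0n.
  - apply: (closed_bounded_compact (z := x0) (r := s1 + 1)); first exact: sqdist_closed_le.
    by move=> x; exact: norm_le_of_sqdist_le.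
  - apply: within_of_for => x Bx; apply: Pfun_continuous.
    by have [] := hO x (le_trans Bx (ltW s1s0)).
have Pc : Pfunc c < M by apply: hlt; exact: le_lt_trans s1s0.
pose h1 := s0 - s1 + K * (s0 - s1) ^+ 2.
have h10 : 0 < h1 by rewrite /h1 ltr_pwDl ?subr_gt0// mulr_ge0 ?sqr_ge0// ltW.
(* [h1] is the barrier on the inner sphere, so there [Pfunc + eta * h] is at most
   [Pfunc c + eta * h1 = M]. *)
pose eta := (M - Pfunc c) / h1.
have eta0 : 0 < eta by rewrite divr_gt0// subr_gt0.
have eh : eta * h1 = M - Pfunc c by rewrite /eta divfK// gt_eqF.
pose h := barrier x0 s0 K.
pose A : set V := [set x | sqdist x0 x <= s0] `&` [set x | s1 <= sqdist x0 x].
have [z [Az1 Az2] hz] : exists2 z, A z &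
    forall x, A x -> Pfunc x + eta * h x <= Pfunc z + eta * h z.
  apply: (@within_compact_max _ _ (fun x => Pfunc x + eta * h x)).
  - by exists p; split; rewrite /= sp// ltW.
  - apply: (closed_bounded_compact (z := x0) (r := s0 + 1)).
      by apply: closedI; [exact: sqdist_closed_le|exact: sqdist_closed_ge].
    by move=> x [Bx _]; exact: norm_le_of_sqdist_le.
  - apply: within_of_for => x [Bx _]; apply: continuous_add.
      by apply: Pfun_continuous; have [] := hO x Bx.
    by apply: continuous_scal; exact: barrier_continuous.
(* The maximum point [z] lies on the outer sphere, where [h] is zero, or on the inner one, where
   [eta] was fitted; in the open annulus the positive Laplacian of [h] contradicts [viscosity]. *)
have wM x : A x -> Pfunc x + eta * h x <= M.
  move=> /hz /le_trans; apply.
  have [Oz Pz] := hO z Az1.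
  rewrite /= in Az1 Az2.
  have [E|E0] := eqVneq (sqdist x0 z) s0.
    by rewrite /h /barrier E subrr expr0n/= mulr0 addr0 mulr0 addr0.
  have [E|E1] := eqVneq (sqdist x0 z) s1.
    rewrite /h /barrier E -/h1 eh; have := hc z; rewrite /Bin/= E lexx => /(_ isT).
    by lra.
  exfalso.
  have lt0 : sqdist x0 z < s0 by rewrite lt_neqAle E0.
  have lt1 : s1 < sqdist x0 z by rewrite lt_neqAle eq_sym E1.
  have [r r0 hr] : exists2 r : R, 0 < r & forall y, `|y - z| < r -> A y.
    apply: nbhs_norm_lt; apply: filterI; last first.
      apply: filterS (near_continuous_gt (@sqdist_continuous R n x0 z) lt1).
      by move=> y /ltW.
    have c1 : {for z, continuous (fun y => - sqdist x0 y)}.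
      by apply: continuousN; exact: sqdist_continuous.
    have := near_continuous_gt (a := - s0) c1.
    rewrite ltrN2 => /(_ lt0); apply: filterS => y /=.
    by rewrite ltrN2 => /ltW.
  have := @viscosity z (fun y => eta * h y) (fun i y => eta * barrier1 x0 s0 K i y)
    (fun i y => eta * barrier2 x0 s0 K i y) r Oz r0.
  rewrite -mulr_sumr sum_barrier2 => hv.
  have q0 := hess_defect_ge0 Oz.
  have : hess_defect z + eta *
     (8 * K * sqdist x0 z - 2 * n%:R * (1 + 2 * K * (s0 - sqdist x0 z))) <= 0.
    apply: hv.
    - by move=> x'; apply: continuous_scal; exact: barrier_continuous.
    - by move=> x' i; apply: is_derive_scal; exact: is_derive_barrier.
    - by move=> x' i; apply: is_derive_scal; exact: is_derive_barrier1.
    - by move=> i; apply: continuous_scal; exact: barrier2_continuous.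
    - by move=> y /hr /hz.
  (* From [K * s1 = n - 1/4], the first term is at least [8 * n - 2] and the second at most
     [3 * n]. *)
  have : 0 < 8 * K * sqdist x0 z - 2 * n%:R * (1 + 2 * K * (s0 - sqdist x0 z)).
    have k1 : K * s1 <= K * sqdist x0 z by rewrite ler_pM2l// ltW.
    have k2 : K * s1 = n%:R - 4^-1.
      by rewrite /s1 mulrA Ks; lra.
    have k3 : 2 * K * (s0 - sqdist x0 z) <= 2^-1.
      have -> : 2 * K * (s0 - sqdist x0 z) = 2 * (K * s0) - 2 * (K * sqdist x0 z) by ring.
      by rewrite Ks; lra.
    have : 2 * n%:R * (1 + 2 * K * (s0 - sqdist x0 z)) <= 3 * n%:R by nra.
    by lra.
  by nra.
pose D := `|x0 - p|.
have D0 : 0 <= D by exact: normr_ge0.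
(* A gradient bound small enough that the loss [n * C * (t * D)] of [Pfunc] stays below the gain
   [eta * s0 * t] of the barrier. *)
pose C := eta * s0 / (2 * (n%:R * D + 1)).
have nD : 0 <= n%:R * D by rewrite mulr_ge0.
have C0 : 0 < C by apply: divr_gt0; [exact: mulr_gt0|lra].
have CE : C * (2 * (n%:R * D + 1)) = eta * s0 by rewrite /C divfK// gt_eqF//; lra.
have [Op _] := hO p (ltac:(by rewrite sp)).
have [r r0 hr] : exists2 r : R, 0 < r & forall y, `|y - p| < r ->
    (Om `&` [set y | forall i, `|Pfun_grad i y| <= C]) y.
  apply: nbhs_norm_lt; apply: filterI; first exact: open_nbhs_nbhs.
  apply: (@filter_forall _ _ (fun i => [set y | `|Pfun_grad i y| <= C]) _ (nbhs_filter p)) => i.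
  have cg := Pfun_grad_continuous (i := i) Op.
  have c1 : {for p, continuous (fun y => - `|Pfun_grad i y|)}.
    by apply: continuousN; apply: (continuous_comp cg); exact: norm_continuous.
  have := near_continuous_gt (a := - C) c1.
  rewrite gp normr0 ltrN2 => /(_ C0); apply: filterS => y /=.
  by rewrite ltrN2 => /ltW.
(* The first bound keeps [y] where the gradient is at most [C]; the second keeps it in the annulus,
   because [(1 - t) ^+ 2 >= 1 - th]. *)
pose t := Num.min (r / (2 * (D + 1))) (th / 2).
have t0 : 0 < t by rewrite lt_min; apply/andP; split; rewrite divr_gt0//; lra.
have tth : t <= th / 2 by rewrite ge_min lexx orbT.
have tr : t * D < r.
  have : t <= r / (2 * (D + 1)) by rewrite ge_min lexx.
  rewrite ler_pdivlMr; last by lra.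
  by nra.
pose y := p + t *: (x0 - p).
have yp : y - p = t *: (x0 - p) by rewrite /y addrAC subrr add0r.
have ypn : `|y - p| = t * D by rewrite yp normrZ gtr0_norm.
have sy : sqdist x0 y = (1 - t) ^+ 2 * s0.
  rewrite -sp /sqdist mulr_sumr; apply: eq_bigr => j _.
  by rewrite -exprMn /y !mxE; congr (_ ^+ 2); ring.
have q1 : (1 - t) ^+ 2 <= 1 - t by rewrite expr2; nra.
have q2 : 1 - th <= (1 - t) ^+ 2 by rewrite expr2; nra.
have Ay : A y.
  split; rewrite /= sy; first by rewrite ler_piMl ?ltW//; lra.
  by rewrite /s1 mulrC ler_pM2r.
have := wM y Ay.
have hy : s0 * t <= h y.
  rewrite /h /barrier sy.
  have le1 : s0 * t <= s0 - (1 - t) ^+ 2 * s0.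
    have : (1 - t) ^+ 2 * s0 <= (1 - t) * s0 by rewrite ler_pM2r.
    by lra.
 apply: le_trans le1 _; rewrite lerDl mulr_ge0 ?sqr_ge0//.
  exact: ltW.
have := @partial_bound_lipschitz R n Pfunc Pfun_grad p r C
  (fun x i xr => is_derive_Pfun i (hr x xr).1) (fun x i xr => (hr x xr).2 i) y.
rewrite ypn => /(_ tr); rewrite Pp ler_norml => /andP[le1 _].
have : n%:R * C * (t * D) < eta * s0 * t.
  have -> : n%:R * C * (t * D) = t * (C * (n%:R * D)) by ring.
  rewrite -CE [ltRHS]mulrC ltr_pM2l//.
  by nra.
by nra.
Qed.

(** * Extremum principles for [u] and [Pfunc], and the case of equality *)

Lemma u_no_local_min z r : (0 < n)%N -> 0 < r ->
  (forall y, `|y - z| < r -> Om y /\ u z <= u y) -> False.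
Proof.
move=> n0 r0 h.
have xs s i : `|s| < r -> `|z + s *: evec R i - z| < r.
  by move=> sr; rewrite addrAC subrr add0r; apply: le_lt_trans sr; exact: norm_scale_evec.
have [Oz _] := h z (ltac:(by rewrite subrr normr0)).
have Hi i : 0 <= H i i z.
  rewrite -oppr_le0.
  apply: (@derive2_local_max R n (fun y => - u y) (fun y => - g i y) z (evec R i) r) => //.
  - by move=> s sr; apply: is_deriveN; apply: der_u; have [] := h _ (xs s i sr).
  - by apply: is_deriveN; exact: der_g.
  - by move=> s sr; rewrite lerN2; have [] := h _ (xs s i sr).
have : 0 <= \sum_(i < n) H i i z by exact: sumr_ge0.
by rewrite lap_u// oppr_ge0 leNgt ltr0n n0.
Qed.

Lemma grad_local_max z r : 0 < r ->
  (forall y, `|y - z| < r -> Om y /\ u y <= u z) -> forall i, g i z = 0.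
Proof.
move=> r0 h i.
have xs s : `|s| < r -> `|z + s *: evec R i - z| < r.
  by move=> sr; rewrite addrAC subrr add0r; apply: le_lt_trans sr; exact: norm_scale_evec.
apply: (@derive_local_max R n u (g i) z (evec R i) r) => // s sr.
  by apply: der_u; have [] := h _ (xs s sr).
by have [] := h _ (xs s sr).
Qed.

(** [Pbar] carries the boundary values, since partial derivatives of [u] are available only inside
    [Om]. Adding [e * sqdist 0] makes the inequality strict and excludes a maximum in [N]; the
    perturbation costs at most [e * B <= d]. *)
Lemma Pfun_le (N : set V) (Pbar : V -> R) (M B : R) : (0 < n)%N ->
  open N -> N `<=` Om -> (forall x, closure N x -> sqdist 0 x <= B) ->
  {within closure N, continuous Pbar} ->
  (forall x, N x -> Pbar x = Pfunc x) ->
  (forall x, closure N x -> ~ N x -> Pbar x <= M) ->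
  forall x, N x -> Pfunc x <= M.
Proof.
move=> n0 oN NO hB cP hP hM x Nx.
have n1 : 1 <= n%:R :> R by rewrite ler1n.
have B0 : 0 <= B by apply: le_trans (hB x (subset_closure Nx)); exact: sqdist_ge0.
apply/ler_addgt0Pr => d d0.
pose e := d / (B + 1).
have e0 : 0 < e by rewrite divr_gt0//; lra.
have ed : e * (B + 1) = d by rewrite /e divfK// gt_eqF//; lra.
have [z cz hz] : exists2 z, closure N z & forall y, closure N y ->
    Pbar y + e * sqdist 0 y <= Pbar z + e * sqdist 0 z.
  apply: (@within_compact_max _ _ (fun y => Pbar y + e * sqdist 0 y)).
  - by exists x; exact: subset_closure.
  - apply: (closed_bounded_compact (z := 0) (r := B + 1)); first exact: closed_closure.
    by move=> y cy; apply: norm_le_of_sqdist_le; exact: hB.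
  - apply: within_continuousD => //; apply: within_of_for => y _.
    by apply: continuous_scal; exact: sqdist_continuous.
have [Nz|nNz] := pselect (N z).
  exfalso; have [r r0 hr] := open_norm_lt oN Nz.
  have := @viscosity z (fun y => e * sqdist 0 y) (fun i y => e * (2 * (y 0 i - (0 : V) 0 i)))
    (fun i y => e * (2 * 1)) r (NO _ Nz) r0.
  rewrite sumr_const card_ord => hv.
  have : hess_defect z + (e * (2 * 1)) *+ n <= 0.
    apply: hv.
    - by move=> y; apply: continuous_scal; exact: sqdist_continuous.
    - by move=> y i; apply: is_derive_scal; exact: is_derive_sqdist.
    - move=> y i; apply: is_derive_scal; apply: is_derive_scal.
      by have := is_derive_coordB y 0 i i; rewrite eqxx.
    - by move=> i; exact: cst_continuous.
    - move=> y /hr Ny; have := hz y (subset_closure Ny).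
      by rewrite hP// hP.
  rewrite -mulr_natl; have := hess_defect_ge0 (NO _ Nz); nra.
have := hM z cz nNz; have := hz x (subset_closure Nx); rewrite hP//.
have := hB z cz; have := sqdist_ge0 0 x; have := sqdist_ge0 0 z.
by nra.
Qed.

(** Connectedness gives a boundary point [b] of [E] inside [Om]. A centre [x0] in [E] close to [b]
    is chosen, and [p] is the point outside [E] nearest to it. *)
Lemma touching_ball (E : set V) : connected Om -> open E -> E `<=` Om ->
  E !=set0 -> (exists2 x, Om x & ~ E x) ->
  exists (x0 p : V) (s0 : R), [/\ 0 < s0,
    forall x, sqdist x0 x <= s0 -> Om x /\ closure E x,
    forall x, sqdist x0 x < s0 -> E x, sqdist x0 p = s0 & ~ E p].
Proof.
move=> cO oE EO [e Ee] [b0 Oo nEo].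
have [b [Ob cb nEb]] : exists b, [/\ Om b, closure E b & ~ E b].
  apply: contrapT => hn; apply: nEo.
  apply: (connected_clopen_sub cO oE _ (EO _ Ee) Ee Oo) => y Oy cy.
  by apply: contrapT => nEy; apply: hn; exists y.
have [r r0 hr] := open_norm_lt Om_open Ob.
have n0 : 0 <= n%:R :> R by [].
(* Points at Euclidean distance at most [|x0 - b|] from [x0] are within [n * d + d] in max norm (a
   crude bound for [sqrt n * d]), hence within [(n + 2) * d = r] of [b]. *)
pose d := r / (n%:R + 2).
have d0 : 0 < d by rewrite divr_gt0//; lra.
have dr : d * (n%:R + 2) = r by rewrite /d divfK// gt_eqF//; lra.
have [x0 Ex0 x0b] := (closure_norm_lt E b).1 cb d d0.
have nearO x : sqdist x0 x <= sqdist x0 b -> Om x.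
  move=> h; apply: hr.
  have h1 : `|x - x0| ^+ 2 <= (n%:R * d + d) ^+ 2.
    apply: le_trans (norm_le_sqdist _ _) _; apply: le_trans h _.
    apply: le_trans (sqdist_le_norm _ _) _; rewrite distrC.
    have : `|x0 - b| ^+ 2 <= d ^+ 2 by rewrite lerXn2r ?nnegrE ?normr_ge0 ?ltW.
    have := sqr_ge0 (`|x0 - b|).
    have nd : 0 <= n%:R * d by rewrite mulr_ge0// ltW.
    by nra.
  have nd : 0 <= n%:R * d by rewrite mulr_ge0// ltW.
  have h2 : `|x - x0| <= n%:R * d + d.
    rewrite -(ler_pXn2r (n := 2))// nnegrE; first exact: normr_ge0.
    by lra.
  have -> : x - b = (x - x0) + (x0 - b) by rewrite addrA subrK.
  by apply: le_lt_trans (ler_normD _ _) _; lra.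
pose Kc : set V := [set x | sqdist x0 x <= sqdist x0 b] `&` ~` E.
have [p [Kp1 Kp2] hp] : exists2 p, Kc p & forall x, Kc x -> - sqdist x0 x <= - sqdist x0 p.
  apply: (@within_compact_max _ _ (fun x => - sqdist x0 x)).
  - by exists b; split => //=.
  - apply: (closed_bounded_compact (z := x0) (r := sqdist x0 b + 1)).
      by apply: closedI; [exact: sqdist_closed_le|exact: open_closedC].
    by move=> x [Bx _]; exact: norm_le_of_sqdist_le.
  - by apply: within_of_for => x _; apply: continuousN; exact: sqdist_continuous.
rewrite /= in Kp1.
have inE' x : sqdist x0 x < sqdist x0 p -> E x.
  move=> xlt; apply: contrapT => nEx.
  have := hp x; rewrite lerN2 leNgt xlt => h; apply: (notF (h _)).
  by split => //=; exact: le_trans (ltW xlt) Kp1.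
have s0 : 0 < sqdist x0 p.
  rewrite lt_neqAle sqdist_ge0 andbT eq_sym; apply/eqP => E0; apply: Kp2.
  have : `|p - x0| = 0.
    apply/eqP; rewrite -sqrf_eq0 eq_le sqr_ge0 andbT -E0; exact: norm_le_sqdist.
  by move/eqP; rewrite normr_eq0 subr_eq0 => /eqP ->.
exists x0, p, (sqdist x0 p); split => // x xle; split.
  by apply: nearO; exact: le_trans Kp1.
apply/closure_norm_lt => r' r'0.
pose D := `|x - x0|.
have D0 : 0 <= D by exact: normr_ge0.
(* Moving [x] slightly towards the centre brings it strictly inside the ball, hence into [E]. *)
pose t := Num.min (r' / (D + 1)) 1 / 2.
have m0 : 0 < Num.min (r' / (D + 1)) 1.
  by rewrite lt_min ltr01 andbT divr_gt0//; lra.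
have m1 : Num.min (r' / (D + 1)) 1 <= 1 by rewrite ge_min lexx orbT.
have t0 : 0 < t by rewrite /t; lra.
have t1 : t <= 2^-1 by rewrite /t; lra.
have tr : t * (D + 1) < r'.
  have : Num.min (r' / (D + 1)) 1 <= r' / (D + 1) by rewrite ge_min lexx.
  by rewrite ler_pdivlMr /t; [nra|lra].
exists (x - t *: (x - x0)); last first.
  rewrite addrAC subrr add0r normrN normrZ (gtr0_norm t0).
  by rewrite -/D; nra.
apply: inE'.
have -> : sqdist x0 (x - t *: (x - x0)) = (1 - t) ^+ 2 * sqdist x0 x.
  rewrite /sqdist mulr_sumr; apply: eq_bigr => j _.
  by rewrite -exprMn !mxE; congr (_ ^+ 2); ring.
have q : (1 - t) ^+ 2 < 1 by rewrite expr2; nra.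
by have := sqdist_ge0 x0 x; nra.
Qed.

Lemma Pfun_constant (N : set V) (M : R) : (0 < n)%N -> connected Om ->
  open N -> N `<=` Om -> (exists2 x, Om x & ~ N x) ->
  (forall x, N x -> Pfunc x <= M) ->
  (forall p, Om p -> closure N p -> ~ N p ->
     Pfunc p = M /\ forall i, Pfun_grad i p = 0) ->
  forall x, N x -> Pfunc x = M.
Proof.
move=> n0 cO oN NO [b0 Oo nNo] hle hb x Nx; apply: contrapT => nP.
pose E : set V := [set y | N y /\ Pfunc y < M].
have Ex : E x by split => //; rewrite lt_neqAle hle// andbT; apply/eqP.
have oE : open E.
  rewrite openE => y [Ny Py].
  have c1 : {for y, continuous (fun y => - Pfunc y)}.
    by apply: continuousN; apply: Pfun_continuous; exact: NO.
  have := near_continuous_gt (a := - M) c1; rewrite ltrN2 => /(_ Py) w.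
  have wN : nbhs y N by exact: open_nbhs_nbhs.
  apply: filterS (filterI wN w) => a [Na /=].
  by rewrite ltrN2.
have EO : E `<=` Om by move=> y [/NO].
have nEb0 : ~ E b0 by case.
have [x0 [p [s0 [s00 hO hE sp nEp]]]] := touching_ball cO oE EO
  (ex_intro _ x Ex) (ex_intro2 _ _ b0 Oo nEb0).
have [Op cEp] := hO p (ltac:(by rewrite sp)).
have cN y : closure E y -> closure N y by apply: closure_subset => a [].
have [Pp gp] : Pfunc p = M /\ forall i, Pfun_grad i p = 0.
  (* The contact point may lie in [N], where [Pfunc] has a local maximum, or on the part of the
     boundary of [N] inside [Om], which [hb] covers. *)
  have [Np|] := pselect (N p); last by apply: hb => //; exact: cN.
  have Pp : Pfunc p = M.
    apply/eqP; rewrite eq_le hle//= leNgt; apply/negP => h; exact: nEp.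
  split => //; have [r r0 hr] := open_norm_lt oN Np.
  apply: (Pfun_grad_local_max r0) => y /hr Ny; split; first exact: NO.
  by rewrite Pp; exact: hle.
apply: (hopf n0 s00 _ _ sp Pp gp) => y ys; last by have [] := hE y ys.
have [Oy cy] := hO y ys; split => //.
apply: (continuous_closure_le (Pfun_continuous Oy) _ cy) => a [_].
exact: ltW.
Qed.

(** For constant [Pfunc] the zero function is an admissible test function everywhere, so [viscosity]
    reads [hess_defect x <= 0]. *)
Lemma Pfun_constant_hess (N : set V) (M : R) : open N -> N `<=` Om ->
  (forall x, N x -> Pfunc x = M) ->
  forall x, N x -> forall i j, H i j x = - (i == j)%:R.
Proof.
move=> oN NO hP x Nx; apply: hess_defect_le0; first exact: NO.
have [r r0 hr] := open_norm_lt oN Nx.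
suff : hess_defect x + \sum_(i < n) 0 <= 0 by rewrite big1_eq addr0.
apply: (@viscosity x (fun=> 0) (fun _ _ => 0) (fun _ _ => 0) r (NO _ Nx) r0).
- by move=> y; exact: cst_continuous.
- by move=> i; exact: cst_continuous.
- by move=> y /hr Ny; rewrite !hP.
Qed.

End PFunction.

(** * Euclidean balls, functions with zero gradient, and segments missing a point *)

Section Geometry.
Variables (R : realType) (n : nat).
Notation V := 'rV[R]_n.
Implicit Types (x y z c : V) (N : set V).

Lemma sqdistxx z : sqdist z z = 0.
Proof. by rewrite /sqdist big1// => j _; rewrite subrr expr0n. Qed.

Lemma sqdist_eq0 z x : sqdist z x = 0 -> x = z.
Proof.
move=> h; apply/eqP; rewrite -subr_eq0 -normr_eq0 -sqrf_eq0 eq_le sqr_ge0 andbT -h.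
exact: norm_le_sqdist.
Qed.

Lemma enormE x : enorm x = Num.sqrt (sqdist 0 x).
Proof.
by rewrite /enorm /sqdist; congr Num.sqrt; apply: eq_bigr => j _; rewrite mxE subr0.
Qed.

Lemma sqdist_convex z x y (t : R) : 0 <= t -> t <= 1 ->
  sqdist z (x + t *: (y - x)) <= (1 - t) * sqdist z x + t * sqdist z y.
Proof.
move=> t0 t1; rewrite /sqdist !mulr_sumr -big_split/=; apply: ler_sum => j _.
rewrite !mxE; set a := x 0 j - _; set b := y 0 j - _.
have -> : x 0 j + t * (y 0 j - x 0 j) - z 0 j = (1 - t) * a + t * b by rewrite /a /b; ring.
rewrite -subr_ge0.
have -> : (1 - t) * a ^+ 2 + t * b ^+ 2 - ((1 - t) * a + t * b) ^+ 2
  = t * (1 - t) * (a - b) ^+ 2 by ring.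
by apply: mulr_ge0; [apply: mulr_ge0 => //; rewrite subr_ge0|exact: sqr_ge0].
Qed.

Lemma sqdist_segment_lt z x y (s : R) : sqdist z x < s -> sqdist z y < s ->
  forall w, segment_set x y w -> sqdist z w < s.
Proof.
move=> xs ys w [t /=]; rewrite in_itv/= => /andP[t0 t1] <-.
apply: le_lt_trans (sqdist_convex z x y t0 t1) _.
have [->|tn] := eqVneq t 1; first by rewrite subrr mul0r add0r mul1r.
have t1' : t < 1 by rewrite lt_neqAle tn.
by nra.
Qed.

(** The Lipschitz bound with constant zero makes [f] locally constant, and connectedness does the
    rest. *)
Lemma partial0_constant N (f : V -> R) a : open N -> connected N -> N a ->
  (forall x, N x -> forall i, is_derive x (evec R i) f 0) ->
  forall x, N x -> f x = f a.
Proof.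
move=> oN cN Na hd.
have loc y : N y -> exists2 r : R, 0 < r & forall w, `|w - y| < r -> N w /\ f w = f y.
  move=> Ny; have [r r0 hr] := open_norm_lt oN Ny; exists r => // w wr; split.
    exact: hr.
  have := @partial_bound_lipschitz R n f (fun _ _ => 0) y r 0
    (fun x i xr => hd x (hr x xr) i) (fun _ _ _ => ltac:(by rewrite normr0)) w wr.
  by rewrite mulr0 mul0r normr_le0 subr_eq0 => /eqP.
pose A : set V := [set x | N x /\ f x = f a].
have oA : open A.
  apply: open_of_norm_lt => y [Ny fy]; have [r r0 hr] := loc y Ny.
  by exists r => // w /hr[Nw fw]; split => //; rewrite fw.
have sub : N `<=` A.
  apply: (@connected_clopen_sub _ _ N A a) => // y Ny /closure_norm_lt cy.
  have [r r0 hr] := loc y Ny; have [w [Nw fw] wy] := cy r r0.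
  by split => //; have [_ <-] := hr w wy.
by move=> x /sub[].
Qed.

(* If [c] lay on all the segments from [x] to points of the open set [N], three
   points of [N] in general position would be on the line through [c] and [x]. *)
Lemma segment_avoiding N c x : (1 < n)%N -> open N -> N !=set0 -> x != c ->
  exists2 y, N y & ~ segment_set y x c.
Proof.
move=> n1 oN [y Ny] xc; apply: contrapT => hn.
have hs w : N w -> exists m : R, w - c = m *: (x - c).
  move=> Nw; have [t _ E] : segment_set w x c.
    by apply: contrapT => h; apply: hn; exists w.
  have t1 : 1 - t != 0.
    apply: contraNneq xc => /eqP; rewrite subr_eq0 => /eqP t1.
    by rewrite -E -t1 scale1r addrC subrK.
  exists (- (t / (1 - t))).
  have -> : w - c = - t *: (x - w) by rewrite -{1}E opprD addrA subrr sub0r scaleNr.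
  have -> : x - c = (1 - t) *: (x - w).
    by rewrite -{1}E; apply/rowP => j; rewrite !mxE; ring.
  by rewrite scalerA mulNr divfK.
have [r r0 hr] := open_norm_lt oN Ny.
have N2 i : N (y + (r / 2) *: evec R i).
  apply: hr; rewrite addrAC subrr add0r; apply: le_lt_trans (norm_scale_evec _ _) _.
  by rewrite gtr0_norm; lra.
pose i0 : 'I_n := Ordinal (ltnW n1).
pose i1 : 'I_n := Ordinal n1.
have [m hm] := hs y Ny; have [m0 hm0] := hs _ (N2 i0); have [m1 hm1] := hs _ (N2 i1).
(* Subtracting the relations makes two different basis vectors multiples of the single vector
   [x - c]. *)
have E0 : (r / 2) *: evec R i0 = (m0 - m) *: (x - c).
  by rewrite scalerBl -hm0 -hm; apply/rowP => j; rewrite !mxE; ring.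
have E1 : (r / 2) *: evec R i1 = (m1 - m) *: (x - c).
  by rewrite scalerBl -hm1 -hm; apply/rowP => j; rewrite !mxE; ring.
have a00 := congr1 (fun v : V => v 0 i0) E0.
have a01 := congr1 (fun v : V => v 0 i1) E0.
have a11 := congr1 (fun v : V => v 0 i1) E1.
move: a00 a01 a11; rewrite !mxE !eqxx/=.
move: (x 0 i1 - c 0 i1) (x 0 i0 - c 0 i0) => b1 b0; rewrite mulr1 mulr0 => a00 /esym/eqP.
rewrite mulf_eq0 => /orP[/eqP h|/eqP ->].
  by move: a00; rewrite h mul0r; lra.
by rewrite mulr0; lra.
Qed.

End Geometry.

(** * Application to the torsion problem: bounds on [N], rigidity, and the value of [tauN] on a
    ball *)

Section Serrin.
Variables (R : realType) (n : nat).
Notation V := 'rV[R]_n.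
Implicit Types (x y z c : V).
Variables (Om : set V) (u : V -> R) (G : V -> V) (N : set V).
Hypothesis n2 : (1 < n)%N.
Hypothesis Om_dom : bounded_domain Om.
Hypothesis sol : serrin_solution Om u G.
Hypothesis compN : components (Om `\` MAXset Om u) N.

Let g i : V -> R := partial i u.
Let H i j : V -> R := partial j (partial i u).
Let M : R := 2 * umax Om u.

Let n0 : (0 < n)%N := ltnW n2.
Let oO : open Om. Proof. by have [_ []] := Om_dom. Qed.
Let cO : connected Om. Proof. by have [_ [_ []]] := Om_dom. Qed.
Let cu : {within closure Om, continuous u}. Proof. by case: sol. Qed.
Let cG : {within closure Om, continuous G}. Proof. by case: sol => _ []. Qed.
Let u_bdry x : bdry Om x -> u x = 0. Proof. by case: sol => _ [_ [h _]]; exact: h. Qed.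

Let der_u x : Om x -> forall i, is_derive x (evec R i) u (g i x).
Proof. by case: sol => _ [_ [_ [h _]]] Ox i; have [d _] := h x Ox i. Qed.

Let G_grad x : Om x -> forall i, G x 0 i = g i x.
Proof. by case: sol => _ [_ [_ [h _]]] Ox i; have [_] := h x Ox i. Qed.

Let der_g x : Om x -> forall i j, is_derive x (evec R j) (g i) (H i j x).
Proof. by case: sol => _ [_ [_ [_ [h _]]]] Ox i j; have d := h i j x Ox. Qed.

Let within_Om (f : V -> R) x : {within Om, continuous f} -> Om x -> {for x, continuous f}.
Proof. by rewrite continuous_open_subspace// => h Ox; apply: h; rewrite inE. Qed.

Let cont_u x : Om x -> {for x, continuous u}.
Proof. by apply: within_Om; apply: continuous_subspaceW cu; exact: subset_closure. Qed.

Let cGi i : {within closure Om, continuous (fun x => G x 0 i)}.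
Proof.
apply: (@within_continuous_comp _ _ _ (closure Om) G (fun v : V => v 0 i)) => // x _.
exact: coord_continuous.
Qed.

Let cont_g x : Om x -> forall i, {for x, continuous (g i)}.
Proof.
move=> Ox i; apply: within_Om => //.
apply: (@subspace_eq_continuous _ Om _ (fun x => G x 0 i)).
  by move=> y; rewrite inE => Oy; exact: G_grad.
exact: (continuous_subspaceW (@subset_closure _ Om) (@cGi i)).
Qed.

Let cont_H x : Om x -> forall i j, {for x, continuous (H i j)}.
Proof.
by move=> Ox i j; apply: within_Om => //; case: sol => _ [_ [_ [_ [_ [h _]]]]]; exact: h.
Qed.

Let lap_u x : Om x -> \sum_(i < n) H i i x = - n%:R.
Proof. by case: sol => _ [_ [_ [_ [_ [_ h]]]]]; exact: h. Qed.

Let bound_Om : exists B : R, forall x, closure Om x -> sqdist 0 x <= B.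
Proof.
have [_ [_ [_ [B hB]]]] := Om_dom; exists (B ^+ 2) => x.
apply: continuous_closure_le; first exact: sqdist_continuous.
move=> y /hB; rewrite enormE => h.
rewrite -[leLHS]sqr_sqrtr ?sqdist_ge0// lerXn2r// nnegrE ?sqrtr_ge0//.
exact: le_trans h.
Qed.

Let compact_closure (A : set V) : A `<=` Om -> compact (closure A).
Proof.
move=> AO; have [B hB] := bound_Om.
apply: (closed_bounded_compact (z := 0) (r := B + 1)); first exact: closed_closure.
by move=> x cx; apply: norm_le_of_sqdist_le; apply: hB; exact: closure_subset cx.
Qed.

Let closure_out x : closure Om x -> u x != 0 -> Om x.
Proof.
move=> cx; apply: contraNP => nO; apply/eqP; apply: u_bdry; by split.
Qed.

Lemma serrin_no_min z (A : set V) : open A -> A `<=` Om -> A z ->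
  (forall y, A y -> u z <= u y) -> False.
Proof.
move=> oA AO Az h; have [r r0 hr] := open_norm_lt oA Az.
apply: (u_no_local_min der_u der_g lap_u n0 r0) => y /hr Ay.
by split; [exact: AO|exact: h].
Qed.

Lemma within_min (A : set V) : A !=set0 -> A `<=` Om ->
  exists2 z, closure A z & forall x, closure A x -> u z <= u x.
Proof.
move=> [a Aa] AO.
have [z cz hz] := @within_compact_max _ _ (fun x => - u x) (closure A)
  (ex_intro _ a (subset_closure Aa)) (compact_closure AO)
  (ltac:(apply: (@within_continuous_comp _ _ _ _ u -%R) => [x _|];
    [exact: opp_continuous|apply: continuous_subspaceW cu; exact: closure_subset])).
by exists z => // x /hz; rewrite lerN2.
Qed.

Lemma serrin_pos x : Om x -> 0 < u x.
Proof.
move=> Ox; have [z cz hz] := within_min (ex_intro _ x Ox) (@subset_refl _ Om).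
have [Oz|nOz] := pselect (Om z).
  by exfalso; apply: (serrin_no_min oO (@subset_refl _ Om) Oz) => y /subset_closure /hz.
have uz : u z = 0 by apply: u_bdry.
rewrite lt_neqAle -{2}uz hz ?andbT; last exact: subset_closure.
(* If [u x] were zero, [x] would itself be an interior minimum point. *)
apply/eqP => ux; apply: (serrin_no_min oO (@subset_refl _ Om) Ox) => y /subset_closure /hz.
by rewrite uz ux.
Qed.

Lemma serrin_max : exists z, [/\ Om z, u z = umax Om u & forall x, closure Om x -> u x <= umax Om u].
Proof.
have [[a Oa] _] := Om_dom.
have [z cz hz] := within_compact_max (ex_intro _ a (subset_closure Oa))
  (compact_closure (@subset_refl _ Om)) cu.
have Oz : Om z.
  apply: closure_out => //; rewrite gt_eqF//.
  by apply: lt_le_trans (serrin_pos Oa) _; apply: hz; exact: subset_closure.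
have ub : ubound (u @` Om) (u z) by move=> _ [x Ox <-]; apply: hz; exact: subset_closure.
have E : u z = umax Om u.
  apply/eqP; rewrite eq_le; apply/andP; split.
    by apply: ub_le_sup; [exists (u z)|exists z].
  by apply: ge_sup => //; exists (u z), z.
by exists z; split => // x /hz; rewrite E.
Qed.

Lemma umax_gt0 : 0 < umax Om u.
Proof. by have [z [Oz <- _]] := serrin_max; exact: serrin_pos. Qed.

Lemma open_minus_max : open (Om `\` MAXset Om u).
Proof.
have [_ [_ _ hM]] := serrin_max.
rewrite openE => x [Ox nx].
have ux : u x < umax Om u.
  rewrite lt_neqAle hM ?andbT; last exact: subset_closure.
  by apply/eqP => E; apply: nx.
have c1 : {for x, continuous (fun y => - u y)} by apply: continuousN; exact: cont_u.
have := near_continuous_gt (a := - umax Om u) c1; rewrite ltrN2 => /(_ ux) w.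
have wO : nbhs x Om by exact: open_nbhs_nbhs.
apply: filterS (filterI wO w) => y [Oy /=]; rewrite ltrN2 => uy.
by split => // -[_ E]; rewrite E ltxx in uy.
Qed.

Let oN : open N. Proof. exact: component_open open_minus_max compN. Qed.
Let NO : N `<=` Om. Proof. by move=> x /(component_sub compN)[]. Qed.
Let cNO x : closure N x -> closure Om x. Proof. by apply: closure_subset; exact: NO. Qed.

Let N_lt x : N x -> u x < umax Om u.
Proof.
move=> Nx; have [Ox nx] := component_sub compN Nx; have [_ [_ _ hM]] := serrin_max.
rewrite lt_neqAle hM ?andbT; last exact: subset_closure.
by apply/eqP => E; apply: nx.
Qed.

Let N_bdry x : closure N x -> ~ N x -> bdry Om x \/ MAXset Om u x.
Proof.
move=> cx nx; have [Ox|nO] := pselect (Om x); last by left; split => //; exact: cNO.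
right; apply: contrapT => nM; apply: nx.
by apply: (component_rel_closed open_minus_max compN) => //; split.
Qed.

(** This makes [tauN] a supremum over a nonempty family. Otherwise the minimum of [u] over the
    closure of [N], excluded from [N] itself, would sit in the maximum set, although [u] is smaller
    than [umax] on [N]. *)
Lemma bdry_closure_nonempty : (bdry Om `&` closure N) !=set0.
Proof.
apply: contrapT => hn.
have [z cz hz] := within_min (component_nonempty compN) NO.
have [Nz|nNz] := pselect (N z).
  by apply: (serrin_no_min oN NO Nz) => y /subset_closure /hz.
have [bz|[_ uz]] := N_bdry cz nNz; first by apply: hn; exists z.
have [a Na] := component_nonempty compN.
by have := hz a (subset_closure Na); rewrite uz leNgt N_lt.
Qed.

Lemma MAX_grad x : MAXset Om u x -> forall i, g i x = 0.
Proof.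
move=> [Ox ux]; have [r r0 hr] := open_norm_lt oO Ox.
have [_ [_ _ hM]] := serrin_max.
apply: (grad_local_max der_u r0) => y /hr Oy; split => //.
by rewrite ux; apply: hM; exact: subset_closure.
Qed.

Let sqrtM_gt0 : 0 < Num.sqrt M.
Proof. by rewrite sqrtr_gt0 /M mulr_gt0// umax_gt0. Qed.

Lemma sqr_enorm x : enorm x ^+ 2 = \sum_(i < n) x 0 i ^+ 2.
Proof. by rewrite /enorm sqr_sqrtr// sumr_ge0// => i _; exact: sqr_ge0. Qed.

Let cG2 : {within closure Om, continuous (fun x => \sum_(i < n) G x 0 i ^+ 2)}.
Proof.
apply: (@within_continuous_comp _ _ _ _ G (fun v : V => \sum_(i < n) v 0 i ^+ 2)) => // x _.
by apply: continuous_bigsum => i; apply: continuous_sqr; exact: coord_continuous.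
Qed.

(** Two nested suprema have to be undone, and each bounds its members only if its set is bounded
    above; the maximum of [|G|] over the compact closure of [Om] provides that. *)
Lemma tauN_le1 : tauN Om u G N <= 1 ->
  forall x, bdry Om x -> closure N x -> enorm (G x) ^+ 2 <= M.
Proof.
move=> t1 x bx cx.
have [[a Oa] _] := Om_dom.
have [z cz hz] := within_compact_max (ex_intro _ a (subset_closure Oa))
  (compact_closure (@subset_refl _ Om)) cG2.
have hL y : closure Om y -> enorm (G y) <= enorm (G z).
  by move=> cy; apply: ler_wsqrtr; exact: hz.
pose A := bdry Om `&` closure N.
have Ax : A x by split.
have S_ub y : has_ubound ((fun x => enorm (G x)) @` connected_component A y).
  exists (enorm (G z)) => _ [w Sw <-]; apply: hL.
  by have [[]] := connected_component_sub Sw.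
have h1 : tauS Om u G (connected_component A x) <= tauN Om u G N.
  apply: ub_le_sup; last by exists (connected_component A x) => //; exists x.
  exists (enorm (G z) / Num.sqrt M) => _ [_ [y Ay <-] <-].
  rewrite /tauS ler_pM2r ?invr_gt0//; apply: ge_sup.
    by exists (enorm (G y)), y => //; exact: connected_component_refl.
  move=> _ [w Sw <-]; apply: hL.
  by have [[]] := connected_component_sub Sw.
have h2 : enorm (G x) <= sup ((fun x => enorm (G x)) @` connected_component A x).
  by apply: ub_le_sup => //; exists x => //; exact: connected_component_refl.
have := le_trans h1 t1; rewrite /tauS ler_pdivrMr// mul1r => h3.
rewrite -(@sqr_sqrtr _ M); last by rewrite /M mulr_ge0// ltW// umax_gt0.
rewrite lerXn2r// ?nnegrE ?sqrtr_ge0//; last exact: le_trans h3.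
Qed.

Lemma tauN_eq1 : (forall x, bdry Om x -> enorm (G x) = Num.sqrt M) -> tauN Om u G N = 1.
Proof.
move=> h; rewrite /tauN.
have S1 S : components (bdry Om `&` closure N) S -> tauS Om u G S = 1.
  move=> [x Ax <-]; rewrite /tauS.
  have -> : (fun x => enorm (G x)) @` connected_component (bdry Om `&` closure N) x
      = [set Num.sqrt M].
    apply/seteqP; split=> [_ [y Sy <-]|_ ->] /=.
      by apply: h; have [] := connected_component_sub Sy.
    by exists x; [exact: connected_component_refl|apply: h; case: Ax].
  by rewrite sup1 divff// gt_eqF.
have [x Ax] := bdry_closure_nonempty.
have -> : [set tauS Om u G S | S in components (bdry Om `&` closure N)] = [set 1].
  apply/seteqP; split=> [_ [S /S1 -> <-]//|_ ->].
  exists (connected_component (bdry Om `&` closure N) x); first by exists x.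
  by apply: S1; exists x.
by rewrite sup1.
Qed.

Lemma serrin_Pfun_le : tauN Om u G N <= 1 -> forall x, N x -> Pfunc u g x <= M.
Proof.
move=> t1; have [B hB] := bound_Om.
apply: (@Pfun_le _ _ Om u g H oO der_u der_g cont_u cont_g cont_H lap_u N
  (fun x => \sum_(i < n) G x 0 i ^+ 2 + 2 * u x) M B n0 oN NO).
- by move=> x /cNO; exact: hB.
- apply: (@continuous_subspaceW _ _ _ (closure Om)); first by move=> x; exact: cNO.
  have c2 : {within closure Om, continuous (u + u)} by exact: within_continuousD.
  have := within_continuousD cG2 c2.
  by congr {within _, continuous _}; apply/funext => x; rewrite !fctE; apply/funext => y; ring.
- move=> x /NO Ox; rewrite /Pfunc; congr (_ + _); apply: eq_bigr => i _.
  by rewrite G_grad.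
- move=> x cx nx; have [bx|mx] := N_bdry cx nx.
    by rewrite -sqr_enorm u_bdry// mulr0 addr0; exact: tauN_le1.
  have [Ox ux] := mx.
  rewrite ux big1 ?add0r// => i _.
  by rewrite G_grad// MAX_grad// expr0n.
Qed.

(** Every term of [Pfun_grad] contains a first derivative of [u], so it vanishes on the maximum set;
    this supplies the gradient condition at contact points outside [N]. *)
Lemma serrin_Pfun_eq : tauN Om u G N <= 1 -> forall x, N x -> Pfunc u g x = M.
Proof.
move=> t1.
apply: (@Pfun_constant _ _ Om u g H oO der_u der_g cont_u cont_g cont_H lap_u N M
  n0 cO oN NO).
- have [z [Oz uz _]] := serrin_max; exists z => // Nz.
  by have := N_lt Nz; rewrite uz ltxx.
- exact: serrin_Pfun_le.
- move=> p Op cp nNp; have [[_ //]|mp] := N_bdry cp nNp.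
  have g0 := MAX_grad mp; have [_ up] := mp.
  split; first by rewrite /Pfunc big1 ?add0r ?up// => i _; rewrite g0 expr0n.
  move=> i; rewrite /Pfun_grad g0 mulr0 addr0 big1// => j _.
  by rewrite g0 mul0r mulr0.
Qed.

Lemma serrin_quadratic : tauN Om u G N <= 1 ->
  exists c, forall x, closure N x -> u x = umax Om u - sqdist c x / 2.
Proof.
move=> t1; have hP := serrin_Pfun_eq t1.
have hH := Pfun_constant_hess oO der_u der_g cont_u cont_g cont_H lap_u oN NO hP.
have [a Na] := component_nonempty compN.
have cN : connected N by case: compN => w _ <-; exact: component_connected.
(* With Hessian [- I], the gradient of [u] plus the position is constant on [N]; that constant is
   the centre. *)
pose c : V := \row_i (g i a + a 0 i).
have gE x i : N x -> g i x = c 0 i - x 0 i.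
  move=> Nx.
  have : g i x + x 0 i = g i a + a 0 i.
    apply: (@partial0_constant _ _ N (fun x => g i x + x 0 i)) => // y Ny j.
    apply: is_derive_eq (is_derive_add (der_g (NO Ny) i j) (is_derive_coord _ _ _)) _.
    by rewrite hH// evecE addNr.
  by rewrite mxE => <-; rewrite addrK.
pose f x := u x + 2^-1 * sqdist c x.
have fE x : N x -> f x = f a.
  apply: (@partial0_constant _ _ N f) => // y Ny j.
  apply: is_derive_eq (is_derive_add (der_u (NO Ny) j)
    (is_derive_scal _ (is_derive_sqdist y c j))) _.
  by rewrite gE//; field.
(* The squared gradient is now [sqdist c x], so the known value [M] of [Pfunc] determines the
   additive constant. *)
have PE x : N x -> Pfunc u g x = 2 * f x.
  move=> Nx; rewrite /Pfunc /f mulrDr addrC; congr (_ + _).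
  rewrite mulrA divff// mul1r; apply: eq_bigr => i _.
  by rewrite gE//; ring.
have uE x : N x -> f x = umax Om u.
  by move=> Nx; have := hP x Nx; rewrite PE// /M; lra.
have cf : {within closure N, continuous f}.
  apply: within_continuousD.
    by apply: continuous_subspaceW cu => x; exact: cNO.
  apply: within_of_for => x _.
  by apply: continuous_scal; exact: sqdist_continuous.
exists c => x cx.
have le1 : f x <= umax Om u by apply: (within_closure_le cf) cx => y /uE ->.
have le2 : - f x <= - umax Om u.
  apply: (@within_closure_le _ _ (fun y => - f y) _ _ _ _ _ cx) => [|y /uE ->//].
  by apply: (@within_continuous_comp _ _ _ _ f -%R) => [y _|//]; exact: opp_continuous.
by move: le1 le2; rewrite /f; lra.
Qed.

Lemma serrin_ball c : (forall x, closure N x -> u x = umax Om u - sqdist c x / 2) ->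
  Om = [set x | sqdist c x < M] /\ Om `<=` closure N.
Proof.
move=> uE; have um := umax_gt0.
have NB x : N x -> 0 < sqdist c x < M.
  move=> Nx; have := uE x (subset_closure Nx).
  by have := N_lt Nx; have := serrin_pos (NO Nx); rewrite /M; lra.
(* In the punctured ball the formula gives [0 < u < umax], so a limit point of [N] is neither on the
   boundary nor in the maximum set. *)
have BN x : 0 < sqdist c x < M -> closure N x -> N x.
  move=> /andP[s0 sM] cx.
  have ux := uE x cx.
  have Ox : Om x.
    by apply: closure_out; [exact: cNO|rewrite gt_eqF// ux; rewrite /M in sM; lra].
  apply: (component_rel_closed open_minus_max compN) => //; split => // -[_].
  by rewrite ux; lra.
(* Continuation along a segment from a point of [N] to [x]; it must miss [c], the one point of the
   ball where [BN] fails. *)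
have allN x : 0 < sqdist c x < M -> N x.
  move=> hx; have /andP[s0 sM] := hx.
  have xc : x != c by apply: contraTneq s0 => ->; rewrite sqdistxx ltxx.
  have [y Ny ncy] := segment_avoiding n2 oN (component_nonempty compN) xc.
  apply: (connected_clopen_sub (@segment_set_connected _ _ y x) oN _
    (segment_setl y x) Ny (segment_setr y x)) => w sw cw.
  apply: BN => //; apply/andP; split.
    rewrite lt_neqAle sqdist_ge0 andbT eq_sym; apply/eqP => /sqdist_eq0 wc.
    by apply: ncy; rewrite -wc.
  by apply: sqdist_segment_lt sw => //; have /andP[] := NB y Ny.
have M0 : 0 < M by rewrite /M mulr_gt0.
have cNc : closure N c.
  apply/closure_norm_lt => r r0.
  (* With [t <= 1] and [t <= M / 2], the squared distance [t ^+ 2] stays below [M]. *)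
  pose t := Num.min (r / 2) (Num.min 1 (M / 2)).
  have t0 : 0 < t by rewrite !lt_min ltr01 !divr_gt0.
  have tr : t <= r / 2 by rewrite ge_min lexx.
  have t1 : t <= 1 by rewrite !ge_min lexx !orbT.
  have tM : t <= M / 2 by rewrite !ge_min lexx !orbT.
  pose i0 : 'I_n := Ordinal n0.
  exists (c + t *: evec R i0); last first.
    rewrite addrAC subrr add0r; apply: le_lt_trans (norm_scale_evec _ _) _.
    by rewrite gtr0_norm//; lra.
  apply: allN.
  have -> : sqdist c (c + t *: evec R i0) = t ^+ 2.
    rewrite /sqdist (bigD1 i0)//= big1 => [|j /negPf ji].
      by rewrite !mxE !eqxx/= addr0; congr (_ ^+ 2); ring.
    by rewrite !mxE ji andbF mulr0 addr0 subrr expr0n.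
  by rewrite exprn_gt0//= expr2; nra.
have Oc : Om c.
  apply: closure_out; first exact: cNO.
  by rewrite uE// sqdistxx mul0r subr0 gt_eqF.
have BcN x : sqdist c x < M -> closure N x.
  move=> sM; have [/sqdist_eq0 ->//|s0] := eqVneq (sqdist c x) 0.
  by apply: subset_closure; apply: allN; rewrite sM andbT lt_neqAle eq_sym s0 sqdist_ge0.
have BO x : sqdist c x < M -> Om x.
  move=> sM; have [/sqdist_eq0 ->//|s0] := eqVneq (sqdist c x) 0.
  by apply: NO; apply: allN; rewrite sM andbT lt_neqAle eq_sym s0 sqdist_ge0.
suff OB : Om `<=` [set x | sqdist c x < M].
  split; first by apply/seteqP; split => [|x] //; exact: BO.
  by move=> x /OB; exact: BcN.
apply: (@connected_clopen_sub _ _ Om _ c) => //=; last by rewrite sqdistxx.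
  rewrite openE => x /= sM.
  have c1 : {for x, continuous (fun y => - sqdist c y)}.
    by apply: continuousN; exact: sqdist_continuous.
  have := near_continuous_gt (a := - M) c1; rewrite ltrN2 => /(_ sM).
  by apply: filterS => y /=; rewrite ltrN2.
(* The ball is relatively closed in [Om]: the formula for [u] persists at its limit points, and
   positivity of [u] keeps them off the sphere. *)
move=> x Ox cx.
have cNx : closure N x.
  by rewrite (closure_id (closure N)).1; [exact: closure_subset cx|exact: closed_closure].
by have := serrin_pos Ox; rewrite uE// /M; lra.
Qed.

Lemma serrin_rigidity : tauN Om u G N <= 1 -> equiv_serrin Om u.
Proof.
move=> t1; have [c uE] := serrin_quadratic t1.
have [OmE OcN] := serrin_ball uE.
have M0 : 0 < M by rewrite /M mulr_gt0// umax_gt0.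
(* The radius of the ball found; it matches the maxima, since [lam ^+ 2 * u0] peaks at
   [lam ^+ 2 / 2]. *)
pose lam := Num.sqrt M.
have lam2 : lam ^+ 2 = M by rewrite /lam sqr_sqrtr// ltW.
have lamn0 : lam != 0 by rewrite gt_eqF.
have nE y : enorm (lam^-1 *: (y - c)) ^+ 2 = sqdist c y / M.
  rewrite sqr_enorm -lam2 /sqdist mulr_suml; apply: eq_bigr => i _.
  by rewrite !mxE exprMn exprVn mulrC.
exists lam, c; split=> //; split.
  apply/seteqP; split=> [y Oy|_ [x Bx <-]].
    exists (lam^-1 *: (y - c)); last by rewrite scalerA divff// scale1r subrK.
    rewrite /unit_ball/= -(ltr_pXn2r (n := 2)) ?nnegrE ?sqrtr_ge0// expr1n nE.
    by rewrite ltr_pdivrMr// mul1r; move: Oy; rewrite {1}OmE.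
  have E : x = lam^-1 *: (lam *: x + c - c) by rewrite addrK scalerA mulVf// scale1r.
  rewrite OmE/= -[ltRHS]mul1r -ltr_pdivrMr// -nE -E expr_lt1//; exact: sqrtr_ge0.
move=> y Oy.
have cy := OcN y Oy.
rewrite uE// /u0 nE lam2 /M.
by field; rewrite gt_eqF// umax_gt0.
Qed.

(** The equivalence describes [u] only inside [Om]. The boundary values of [G] come from continuity:
    [G x = c - x] extends to the sphere, where its length is [lam = Num.sqrt M]. *)
Lemma equiv_serrin_tauN : equiv_serrin Om u -> tauN Om u G N = 1.
Proof.
move=> [lam [c [lam0 [OmE uE0]]]].
have lamn0 : lam != 0 by rewrite gt_eqF.
have nE y : enorm (lam^-1 *: (y - c)) ^+ 2 = sqdist c y / lam ^+ 2.
  rewrite sqr_enorm /sqdist mulr_suml; apply: eq_bigr => i _.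
  by rewrite !mxE exprMn exprVn mulrC.
have l20 : 0 < lam ^+ 2 by rewrite exprn_gt0.
have uE y : Om y -> u y = 2^-1 * lam ^+ 2 + - 2^-1 * sqdist c y.
  by move=> /uE0 ->; rewrite /u0 nE; field.
have OmB y : Om y <-> sqdist c y < lam ^+ 2.
  rewrite -[ltRHS]mul1r -ltr_pdivrMr// -nE expr_lt1//; last exact: sqrtr_ge0.
  rewrite OmE; split=> [[x Bx <-]|By]; first by rewrite addrK scalerA mulVf// scale1r.
  by exists (lam^-1 *: (y - c)) => //; rewrite scalerA divff// scale1r subrK.
(* The value of [u] at the centre is at most the maximum, and the explicit formula at a maximum
   point gives the reverse bound. *)
have ME : M = lam ^+ 2.
  have Oc : Om c by apply/OmB; rewrite sqdistxx.
  have [z [Oz uz hM]] := serrin_max.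
  have := hM c (subset_closure Oc); rewrite (uE c)// sqdistxx /M -uz uE//.
  by have := sqdist_ge0 c z; lra.
have gE y i : Om y -> G y 0 i + (y 0 i - c 0 i) = 0.
  move=> Oy; rewrite G_grad//.
  have d : is_derive y (evec R i) u (0 + - 2^-1 * (2 * (y 0 i - c 0 i))).
    apply: (@near_eq_is_derive _ _ _ (fun y => 2^-1 * lam ^+ 2 + - 2^-1 * sqdist c y)).
      have : nbhs y Om by exact: open_nbhs_nbhs.
      by apply: filterS => w /uE ->.
    apply: is_derive_add.
    by apply: is_derive_scal; exact: is_derive_sqdist.
  have -> : g i y = 0 + - 2^-1 * (2 * (y 0 i - c 0 i)).
    by rewrite -(@derive_val _ _ _ _ _ _ _ d).
  by field.
apply: tauN_eq1 => x [cx nOx].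
have cf i : {within closure Om, continuous (fun y => G y 0 i + (y 0 i - c 0 i))}.
  apply: within_continuousD; first exact: cGi.
  apply: within_of_for => y _.
  by apply: continuous_sub; [exact: coord_continuous|exact: cst_continuous].
have GE i : G x 0 i = - (x 0 i - c 0 i).
  have le1 : G x 0 i + (x 0 i - c 0 i) <= 0.
    by apply: (within_closure_le (@cf i) _ cx) => y /gE ->.
  have le2 : - (G x 0 i + (x 0 i - c 0 i)) <= 0.
    apply: (@within_closure_le _ _ (fun y => - (G y 0 i + (y 0 i - c 0 i))) _ _ _ _ _ cx).
      apply: (@within_continuous_comp _ _ _ _
        (fun y => G y 0 i + (y 0 i - c 0 i)) -%R) => [y _|]; last exact: (@cf i).
      exact: opp_continuous.
    by move=> y /gE ->; rewrite oppr0.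
  by lra.
have sx : sqdist c x = lam ^+ 2.
  apply/eqP; rewrite eq_le; apply/andP; split.
    apply: (continuous_closure_le (@sqdist_continuous _ _ c x) _ cx).
    by move=> y /OmB/ltW.
  by rewrite leNgt; apply/negP => /OmB.
rewrite /enorm; congr Num.sqrt; rewrite ME -sx /sqdist.
by apply: eq_bigr => i _; rewrite GE sqrrN.
Qed.

End Serrin.

Theorem theorem3p3 (R : realType) (n : nat) (Om : set 'rV[R]_n)
  (u : 'rV[R]_n -> R) (G : 'rV[R]_n -> 'rV[R]_n) (N : set 'rV[R]_n) :
  (3 <= n)%N ->
  bounded_domain Om -> smooth_boundary Om ->
  serrin_solution Om u G ->
  components (Om `\` MAXset Om u) N ->
  1 <= tauN Om u G N /\ (tauN Om u G N = 1 <-> equiv_serrin Om u).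
Proof.
move=> n3 dom _ sol compN; have n2 : (1 < n)%N by exact: ltnW.
have rig : tauN Om u G N <= 1 -> equiv_serrin Om u by exact: serrin_rigidity.
have eq1 : equiv_serrin Om u -> tauN Om u G N = 1 by exact: equiv_serrin_tauN.
split; last by split=> [t1|]; [apply: rig; rewrite t1|exact: eq1].
by rewrite leNgt; apply/negP => t1; have := t1; rewrite (eq1 (rig (ltW t1))) ltxx.
Qed.
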